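(* Let $T>0$ and let $V$ and $H$ be Hilbert spaces such that $V$ is compactly embedded in $H$. For every $N\in\mathbb{N}$ put $\Delta t=T/N$, and let $\mathbf{u}_{\Delta t}\in L^2(0,T;H)$ be given by $\mathbf{u}_{\Delta t}(t,\cdot)=\mathbf{u}_{\Delta t}^n$ for $t\in((n-1)\Delta t,n\Delta t]$, $n=1,\dots,N$. Let $V^n_{\Delta t}$ ($1\le n\le N$) and $Q^n_{\Delta t}$ ($0\le n\le N$) be Hilbert spaces continuously embedded in $V$, with embedding constants independent of $\Delta t$ and $n$, such that $V^n_{\Delta t}\subset\subset \overline{Q^n_{\Delta t}}^H\hookrightarrow (Q^n_{\Delta t})'$. Let $\mathbf{u}^n_{\Delta t}\in V^n_{\Delta t}$ for $n=1,\dots,N$ and $\mathbf{u}^0_{\Delta t}\in H$. Suppose that the following holds. (A) There is a constant $C>0$ such that for every $\Delta t$: (A1) $\sum_{n=1}^N\|\mathbf{u}^n_{\Delta t}\|^2_{V^n_{\Delta t}}\Delta t\le C$; (A2) $\|\mathbf{u}_{\Delta t}\|_{L^\infty(0,T;H)}\le C$; (A3) $\|\tau_{\Delta t}\mathbf{u}_{\Delta t}-\mathbf{u}_{\Delta t}\|^2_{L^2(\Delta t,T;H)}\le C\Delta t$. (B) There is a constant $C>0$, independent of $\Delta t$ and $n$, such that $$\Big\|P^n_{\Delta t}\frac{\mathbf{u}^{n+1}_{\Delta t}-\mathbf{u}^n_{\Delta t}}{\Delta t}\Big\|_{(Q^n_{\Delta t})'}\le C\big(\|\mathbf{u}^{n+1}_{\Delta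 t}\|_{V^{n+1}_{\Delta t}}+1\big),\qquad n=0,\dots,N-1,$$ where $P^n_{\Delta t}$ is the orthogonal projector of $H$ onto $\overline{Q^n_{\Delta t}}^H$. (C1) For every $\Delta t$, every $l\in\{1,\dots,N\}$ and $n\in\{1,\dots,N-l\}$ there exist a Hilbert space $Q^{n,l}_{\Delta t}\subset V$ and operators $J^i_{\Delta t,l,n}:Q^{n,l}_{\Delta t}\to Q^{n+i}_{\Delta t}$, $i=0,1,\dots,l$, such that for all $\mathbf{q}\in Q^{n,l}_{\Delta t}$ $$\|J^i_{\Delta t,l,n}\mathbf{q}\|_{Q^{n+i}_{\Delta t}}\le C\|\mathbf{q}\|_{Q^{n,l}_{\Delta t}},\qquad i\in\{0,\dots,l\},$$ $$\big(J^{j+1}_{\Delta t,l,n}\mathbf{q}-J^j_{\Delta t,l,n}\mathbf{q},\,\mathbf{u}^{n+j+1}_{\Delta t}\big)_H\le C\Delta t\,\|\mathbf{q}\|_{Q^{n,l}_{\Delta t}}\|\mathbf{u}^{n+j+1}_{\Delta t}\|_{V^{n+j+1}_{\Delta t}},\qquad j\in\{0,\dots,l-1\},$$ $$\|J^i_{\Delta t,l,n}\mathbf{q}-\mathbf{q}\|_H\le C\sqrt{l\Delta t}\,\|\mathbf{q}\|_{Q^{n,l}_{\Delta t}},\qquad i\in\{0,\dots,l\},$$ where $C>0$ is independent of $\Delta t,n,l$. (C2) Let $V^{n,l}_{\Delta t}=\overline{Q^{n,l}_{\Delta t}}^V$. There exist functions $I^i_{\Delta t,l,n}:V^{n+i}_{\Delta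 t}\to V^{n,l}_{\Delta t}$, $i=0,\dots,l$, a universal constant $C>0$ and a universal monotonically increasing function $g:\mathbb{R}_+\to\mathbb{R}_+$ with $g(h)\to0$ as $h\to0$ such that for every $\mathbf{v}\in V^{n+i}_{\Delta t}$ and $i\in\{0,\dots,l\}$ $$\|I^i_{\Delta t,l,n}\mathbf{v}\|_{V^{n,l}_{\Delta t}}\le C\|\mathbf{v}\|_{V^{n+i}_{\Delta t}},\qquad \|I^i_{\Delta t,l,n}\mathbf{v}-\mathbf{v}\|_H\le g(l\Delta t)\|\mathbf{v}\|_{V^{n+i}_{\Delta t}}.$$ (C3) For every $\delta>0$ there is a constant $C(\delta)$, independent of $n,l,\Delta t$, such that $$\|\mathbf{v}\|_H\le\delta\|\mathbf{v}\|_{V^{n,l}_{\Delta t}}+C(\delta)\|\mathbf{v}\|_{(Q^{n,l}_{\Delta t})'},\qquad \mathbf{v}\in V^{n,l}_{\Delta t}.$$ Then the family $\{\mathbf{u}_{\Delta t}\}_{N\in\mathbb{N}}$ is relatively compact in $L^2(0,T;H)$.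
   Context: Time shifts: $\tau_h\mathbf{f}(t,\cdot)=\mathbf{f}(t-h,\cdot)$. Elements of $V^n_{\Delta t}$, $Q^n_{\Delta t}$, $Q^{n,l}_{\Delta t}$ are identified with their images in $V\subset H$. $\overline{X}^H$ and $\overline{X}^V$ denote closures in $H$ and in $V$; $V^{n,l}_{\Delta t}$ carries the norm of $V$. $\subset\subset$ denotes compact embedding and $\hookrightarrow$ continuous embedding. For $X=Q^n_{\Delta t}$ or $X=Q^{n,l}_{\Delta t}$ the space $\overline{X}^H$ is identified with its dual, so that $\overline{X}^H\hookrightarrow X'$ via $\mathbf{f}\mapsto(\mathbf{f},\cdot)_H$ and $\|\mathbf{f}\|_{X'}=\sup\{|(\mathbf{f},\mathbf{q})_H|:\mathbf{q}\in X,\ \|\mathbf{q}\|_X\le1\}$. ''Universal constant'' means independent of $\Delta t$, $n$, $l$ and $i$. *)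

(* Defs.v *)
From HB Require Import structures.
From mathcomp Require Import all_boot all_order all_algebra.
From mathcomp Require Import all_classical all_reals all_analysis.
From mathcomp Require Import measurable_realfun.

Set Implicit Arguments.
Unset Strict Implicit.
Unset Printing Implicit Defensive.

Import Order.TTheory GRing.Theory Num.Theory.
Import numFieldNormedType.Exports.

Local Open Scope classical_set_scope.
Local Open Scope ring_scope.

(* Real Hilbert spaces: complete normed modules whose norm comes from an inner
   product. *)
HB.mixin Record CompleteNormedModule_isHilbert (R : realType) V
    & CompleteNormedModule R V := {
  hdot : V -> V -> R ;
  hdotC : forall x y, hdot x y = hdot y x ;
  hdotDl : forall x y z, hdot (x + y) z = hdot x z + hdot y z ;
  hdotZl : forall (a : R) x y, hdot (a *: x) y = a * hdot x y ;
  hdotxx : forall x, hdot x x = `|x| ^+ 2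
}.

#[short(type="hilbertType")]
HB.structure Definition Hilbert (R : realType) :=
  {V of CompleteNormedModule_isHilbert R V & CompleteNormedModule R V}.

Section Embeddings.
Context {R : realType} {X Y : normedModType R}.

(* Linearity is carried by the type of the embeddings, {linear X -> Y}. *)
Definition continuous_embedding (e : X -> Y) := injective e /\ continuous e.

Definition embedding_with_constant (C : R) (e : X -> Y) :=
  injective e /\ forall x, `|e x| <= C * `|x|.

Definition compact_embedding (e : X -> Y) :=
  continuous_embedding e /\
  forall A : set X, bounded_set A -> precompact (e @` A).

End Embeddings.

Section HilbertNotions.
Context {R : realType} {X H : hilbertType R}.
Implicit Types (e : X -> H) (f : H) (K : set H).

(* The norm of the functional (f, .)_H in the dual of X, where X is seen as a
   subspace of H through e. *)
Definition dual_norm e f : \bar R :=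
  ereal_sup [set (`|hdot f (e q)|)%:E | q in [set q : X | `|q| <= 1]].

(* f |-> (f, .)_H is a continuous embedding of the closure of X in H into the
   dual of X. *)
Definition dual_embedding e :=
  {in closure (range e) &,
     injective (fun f => (fun q : X => hdot f (e q)))} /\
  exists2 C : R, 0 < C &
    forall f, closure (range e) f -> (dual_norm e f <= (C * `|f|)%:E)%E.

Definition orthogonal_projector K (P : H -> H) :=
  forall x, K (P x) /\ forall y, K y -> hdot (x - P x) y = 0.

End HilbertNotions.

Section BochnerSpaces.
Context {R : realType} {H : normedModType R}.
Implicit Types (f g : R -> H) (a b : R).

Definition simple_function f :=
  finite_set (range f) /\ forall y, measurable (f @^-1` [set y]).

Definition strongly_measurable (D : set R) f :=
  exists2 s : nat -> R -> H, (forall k, simple_function (s k)) &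
    forall t, D t -> s k t @[k --> \oo] --> f t.

(* The norm of L^p(a, b; H). *)
Definition bochner_norm (p : \bar R) a b f : \bar R :=
  'N[lebesgue_measure]_p[EFin \o ((fun t => `|f t|) \_ `]a, b[)].

Definition time_shift (h : R) f : R -> H := fun t => f (t - h).

End BochnerSpaces.

Section BochnerLemmas.
Context {R : realType} {H : normedModType R}.
Implicit Types (u v w : R -> H) (a b : R) (D : set R).

Lemma simple_functionB u v : simple_function u -> simple_function v ->
  simple_function (u \- v).
Proof.
move=> [fu mu] [fv mv]; split.
  apply: (sub_finite_set _ (finite_image2 (fun x y : H => x - y) fu fv)).
  by move=> _ [t _ <-]/=; exists (u t); [by exists t|exists (v t); [by exists t|by []]].
move=> y.
rewrite (_ : _ @^-1` _ =
  \bigcup_(z in range u) (u @^-1` [set z] `&` v @^-1` [set z - y])).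
  by apply: fin_bigcup_measurable => // z _; exact: measurableI.
apply/seteqP; split => [t /= <-|t [z _ [/= -> ->]]]; last by rewrite subKr.
by exists (u t) => //; split => //=; rewrite subKr.
Qed.

Lemma strongly_measurableB D u v :
  strongly_measurable D u -> strongly_measurable D v ->
  strongly_measurable D (u \- v).
Proof.
move=> [su mu cu] [sv mv cv]; exists (fun k => su k \- sv k).
  by move=> k; exact: simple_functionB.
by move=> t Dt; apply: cvgB; [exact: cu|exact: cv].
Qed.

Lemma simple_function_norm u : simple_function u ->
  measurable_fun [set: R] (fun t => `|u t|).
Proof.
move=> [fu mu] _ B mB; rewrite setTI.
rewrite (_ : _ @^-1` _ =
  \bigcup_(z in range u `&` [set z | B `|z|]) u @^-1` [set z]).
  by apply: fin_bigcup_measurable => //; exact: finite_setIl.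
by apply/seteqP; split => [t /= But|t [z [_ /= Bz] /= ->]//]; exists (u t).
Qed.

Lemma strongly_measurable_norm D u : measurable D -> strongly_measurable D u ->
  measurable_fun [set: R] ((fun t => `|u t|) \_ D).
Proof.
move=> mD [s ms cs]; apply: (iffLR (measurable_restrictT _ mD)).
apply: (@measurable_fun_cvg _ _ _ D (fun k t => `|s k t|) (fun t => `|u t|)).
  by move=> k; apply/measurable_funTS; exact: simple_function_norm.
by move=> t Dt; apply: cvg_norm; exact: cs.
Qed.

Lemma bochner_norm_ge0 p a b u : (0 <= bochner_norm p a b u)%E.
Proof. exact: Lnorm_ge0. Qed.

Lemma le_bochner_normD a b u v w :
  strongly_measurable `]a, b[ u -> strongly_measurable `]a, b[ v ->
  strongly_measurable `]a, b[ w -> (forall t, `|w t| <= `|u t| + `|v t|) ->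
  (bochner_norm 2%:E a b w <=
   bochner_norm 2%:E a b u + bochner_norm 2%:E a b v)%E.
Proof.
move=> mu mv mw wuv.
have mI : measurable (`]a, b[ : set R) by [].
have nu := strongly_measurable_norm mI mu.
have nv := strongly_measurable_norm mI mv.
have nw := strongly_measurable_norm mI mw.
have r0 (z : R -> H) t : 0 <= ((fun t => `|z t|) \_ `]a, b[) t.
  by rewrite /patch; case: ifP.
rewrite /bochner_norm.
apply: (le_trans _ (@eminkowski _ _ _ lebesgue_measure _ _ 2%:E nu nv _));
  last by rewrite lee_fin ler1n.
have k0 : (0 <= (2 : R)^-1)%R by rewrite invr_ge0.
rewrite unlock /Lnorm; apply: gt0_ler_poweR => //.
- by rewrite in_itv/= leey andbT; apply: integral_ge0 => t _ /=; rewrite lee_fin powR_ge0.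
- by rewrite in_itv/= leey andbT; apply: integral_ge0 => t _ /=; rewrite lee_fin powR_ge0.
apply: ge0_le_integral => //=.
- apply/measurable_EFinP; apply: (measurableT_comp (measurable_powR 2)).
  exact: measurableT_comp.
- apply/measurable_EFinP; apply: (measurableT_comp (measurable_powR 2)).
  by apply: measurableT_comp => //; exact: measurable_funD.
- move=> t _; rewrite lee_fin ge0_ler_powR ?nnegrE//.
  rewrite !ger0_norm ?addr_ge0//.
  by rewrite /patch; case: ifP => // _; rewrite addr0.
Qed.

End BochnerLemmas.

(* Square integrable functions on ]a, b[; the values outside of ]a, b[ are
   irrelevant. *)
Record L2fun (R : realType) (a b : R) (H : normedModType R) := MkL2fun {
  L2fun_fun :> R -> H ;
  L2fun_meas : strongly_measurable `]a, b[ L2fun_fun ;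
  L2fun_fin : (bochner_norm 2%:E a b L2fun_fun < +oo)%E
}.

HB.instance Definition _ (R : realType) (a b : R) (H : normedModType R) :=
  gen_eqMixin (L2fun a b H).
HB.instance Definition _ (R : realType) (a b : R) (H : normedModType R) :=
  gen_choiceMixin (L2fun a b H).

Section L2space.
Context {R : realType} (a b : R) (H : normedModType R).
Implicit Types f g h : L2fun a b H.

Definition L2eq f g : bool :=
  `[< f = g %[ae (@lebesgue_measure R) in ([set` `]a, b[] : set R)] >].

Let L2eq_refl : reflexive L2eq.
Proof. by move=> f; apply/asboolP; exact: ae_eq_refl. Qed.

Let L2eq_sym : symmetric L2eq.
Proof.
by move=> f g; apply/idP/idP => /asboolP E; apply/asboolP; exact: ae_eq_sym.
Qed.

Let L2eq_trans : transitive L2eq.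
Proof.
by move=> f g h /asboolP gf /asboolP fh; apply/asboolP; exact: ae_eq_trans fh.
Qed.

Canonical L2eq_canonical := EquivRel L2eq L2eq_refl L2eq_sym L2eq_trans.

(* L^2(a, b; H): square integrable functions up to equality a.e. *)
Definition L2 : Type := {eq_quot L2eq}%qT.
HB.instance Definition _ := Choice.on L2.
HB.instance Definition _ := EqQuotient.on L2.

Definition L2class (f : L2fun a b H) : L2 := (\pi_L2 f)%qT.

Let L2subM f g : strongly_measurable `]a, b[ (f \- g).
Proof. by apply: strongly_measurableB; exact: L2fun_meas. Qed.

Let L2sub_fin f g :
  bochner_norm 2%:E a b (fun t => f t - g t) \is a fin_num.
Proof.
rewrite ge0_fin_numE ?bochner_norm_ge0//.
apply: (@le_lt_trans _ _
  (bochner_norm 2%:E a b f + bochner_norm 2%:E a b g)%E).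
  apply: le_bochner_normD (L2fun_meas f) (L2fun_meas g) (L2subM f g) _ => t.
  exact: ler_normB.
by rewrite lte_add_pinfty//; exact: L2fun_fin.
Qed.

Definition L2dist (x y : L2) : R :=
  fine (bochner_norm 2%:E a b (fun t => repr x t - repr y t)).

Let L2distxx x : L2dist x x = 0.
Proof.
rewrite /L2dist /bochner_norm (_ : EFin \o _ = cst 0%E).
  by rewrite Lnorm0// eqe pnatr_eq0.
by apply/funext => t /=; rewrite /patch subrr normr0; case: ifP.
Qed.

Let L2dist_positivity x y : L2dist x y = 0 -> x = y.
Proof.
move=> xy0; have N0 : bochner_norm 2%:E a b (fun t => repr x t - repr y t) = 0%E.
  by rewrite -[LHS]fineK ?L2sub_fin//; congr EFin.
have mxy : measurable_fun [set: R]
    (EFin \o ((fun t => `|repr x t - repr y t|) \_ `]a, b[)).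
  apply/measurable_EFinP; apply: strongly_measurable_norm => //.
  exact: L2subM.
have p0 : (0 < 2%:E :> \bar R)%E by rewrite lte_fin.
have E := @Lnorm_eq0_eq0 _ _ _ lebesgue_measure _ _ mxy p0 N0.
rewrite -[x]reprK -[y]reprK; apply/eqmodP/asboolP.
apply: (@filterS _ _ (ae_filter_ringOfSetsType lebesgue_measure) _ _ _ E).
move=> t /= /(_ I) + abt; rewrite /patch mem_set//.
by move=> [] /normr0_eq0/eqP; rewrite subr_eq0 => /eqP.
Qed.

Let L2dist_sym x y : L2dist x y = L2dist y x.
Proof.
rewrite /L2dist; congr (fine (Lnorm _ _ _)); apply/funext => t /=.
by rewrite /patch distrC.
Qed.

Let L2dist_triangle y x z : L2dist x z <= L2dist x y + L2dist y z.
Proof.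
rewrite -fineD ?L2sub_fin// fine_le ?fin_numD ?L2sub_fin//.
by apply: le_bochner_normD; do ?[exact: L2subM] => t; exact: ler_distD.
Qed.

HB.instance Definition _ := isMetric.Build R L2
  L2distxx L2dist_positivity L2dist_sym L2dist_triangle.

End L2space.

Definition timestep {R : realType} (T : R) (N : nat) : R := T / N%:R.

(* Main.v *)
Require Import Defs.
From HB Require Import structures.
From mathcomp Require Import all_boot all_order all_algebra.
From mathcomp Require Import all_classical all_reals all_analysis.
From mathcomp Require Import measurable_realfun ring lra.

Set Implicit Arguments.
Unset Strict Implicit.
Unset Printing Implicit Defensive.

Import Order.TTheory GRing.Theory Num.Theory.
Import numFieldNormedType.Exports.

Local Open Scope classical_set_scope.
Local Open Scope ring_scope.

(* Write a_n = |u^n|_{V^n}. The point is the pointwise bound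
   |u^{n+l} - u^n|_H <= eps (a_{n+l} + a_n + 1) as soon as l dt <= h0(eps).
   By (C2) the difference is replaced by an element d of V^{n,l}, and by (C3)
   only the dual norm of d matters; (u^{n+l} - u^n, q) telescopes along J^i q,
   and each increment is controlled by (B) and (C1).

   Cut (0,T) into finitely many cells of length tau <= h0 / 2 and represent the
   cell by the value u^m of least a_m among the steps meeting it. Since a_m is
   minimal, |u(t) - u^m| <= eps (2 a(t) + 1) on the cell and
   tau a_m^2 <= int a^2 <= C. So the representatives lie in the image of a fixed
   ball of V, which is precompact in H, and the family is totally bounded in
   L^2. As its members are step functions, completeness is only needed for
   Cauchy sequences of simple functions. *)

(** * Hilbert spaces *)

Section InnerProduct.
Context {R : realType} {H : hilbertType R}.
Implicit Types x y z : H.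

Lemma hdotDr x y z : hdot x (y + z) = hdot x y + hdot x z.
Proof. by rewrite hdotC hdotDl !(hdotC _ x). Qed.

Lemma hdotNl x y : hdot (- x) y = - hdot x y.
Proof. by rewrite -scaleN1r hdotZl mulN1r. Qed.

Lemma hdotNr x y : hdot x (- y) = - hdot x y.
Proof. by rewrite hdotC hdotNl hdotC. Qed.

Lemma hdotBl x y z : hdot (x - y) z = hdot x z - hdot y z.
Proof. by rewrite hdotDl hdotNl. Qed.

Lemma hdotBr x y z : hdot x (y - z) = hdot x y - hdot x z.
Proof. by rewrite hdotDr hdotNr. Qed.

Lemma hdot0l x : hdot 0 x = 0.
Proof. by have := hdotZl 0 0 x; rewrite scale0r mul0r. Qed.

Lemma hdot_CauchySchwarz x y : `|hdot x y| <= `|x| * `|y|.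
Proof.
have [->|x0] := eqVneq x 0; first by rewrite hdot0l !normr0 mul0r.
have n0 : 0 < `|x| by rewrite normr_gt0.
have := sqr_ge0 `|(`|x| ^+ 2) *: y - hdot x y *: x|.
rewrite -hdotxx hdotBl !hdotBr !hdotZl !(hdotC _ (_ *: _)) !hdotZl !hdotxx.
rewrite (hdotC y x) => h.
have {}h : 0 <= `|x| ^+ 2 * ((`|x| * `|y|) ^+ 2 - hdot x y ^+ 2) by nra.
rewrite pmulr_rge0 ?exprn_gt0// subr_ge0 in h.
by rewrite -(@ler_pXn2r _ 2)// ?nnegrE ?mulr_ge0// real_normK ?num_real.
Qed.

Lemma hdot_le x y : hdot x y <= `|x| * `|y|.
Proof. exact: le_trans (ler_norm _) (hdot_CauchySchwarz x y). Qed.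

(** The sum telescopes to the difference of [hdot (x j) (y j)] between [j = l] and [j = 0]. With
    [y j] standing for $J^jq$, increments of [y] meet [x j.+1] as in (C1), and increments of [x]
    meet [y j], an element of $Q^{n+j}$, as in (B). *)
Lemma hdot_summation_by_parts (x y : nat -> H) q l :
  hdot (x l - x 0%N) q = hdot (x l) (q - y l) + hdot (x 0%N) (y 0%N - q)
    + \sum_(j < l) (hdot (y j.+1 - y j) (x j.+1) + hdot (x j.+1 - x j) (y j)).
Proof.
have -> : \sum_(j < l) (hdot (y j.+1 - y j) (x j.+1) + hdot (x j.+1 - x j) (y j))
    = hdot (x l) (y l) - hdot (x 0%N) (y 0%N).
  elim: l => [|l IH]; first by rewrite big_ord0 subrr.
  rewrite big_ord_recr/= IH !hdotBl (hdotC (y l.+1)) (hdotC (y l)); lra.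
rewrite !hdotBl !hdotBr; lra.
Qed.

End InnerProduct.

Section DualNorm.
Context {R : realType} {X H : hilbertType R}.

Lemma dual_norm_le (e : X -> H) f (M : R) :
  (forall q, `|q| <= 1 -> `|hdot f (e q)| <= M) -> (dual_norm e f <= M%:E)%E.
Proof. by move=> h; apply: ge_ereal_sup => _ [q /= q1 <-]; rewrite lee_fin h. Qed.

Lemma dual_norm_ge (e : X -> H) f q :
  `|q| <= 1 -> (`|hdot f (e q)|%:E <= dual_norm e f)%E.
Proof. by move=> q1; apply: ereal_sup_ubound; exists q. Qed.

Lemma dual_norm_ge0 (e : X -> H) f : (0 <= dual_norm e f)%E.
Proof.
apply: le_trans (dual_norm_ge e f (q := 0) _); first by rewrite lee_fin.
by rewrite normr0.
Qed.

Lemma hdot_le_dual_norm (e : {linear X -> H}) f (M : R) q :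
  (dual_norm e f <= M%:E)%E -> `|hdot f (e q)| <= M * `|q|.
Proof.
move=> fM; have [->|q0] := eqVneq q 0.
  by rewrite linear0 hdotC hdot0l !normr0 mulr0.
have n0 : 0 < `|q| by rewrite normr_gt0.
rewrite -ler_pdivrMr// -lee_fin.
apply: le_trans fM; apply: le_trans (dual_norm_ge e f (q := `|q|^-1 *: q) _).
  rewrite linearZ_LR (hdotC f (_ *: _)) hdotZl (hdotC _ f) normrM gtr0_norm ?invr_gt0//.
  by rewrite lee_fin mulrC.
by rewrite normrZ gtr0_norm ?invr_gt0// mulVf ?normr_eq0.
Qed.

End DualNorm.

(** (C3) lives on the closure $V^{n,l}$ and will be applied to a difference of two values of $I$. *)
Lemma closure_rangeB {R : realType} {X V : normedModType R} (e : {linear X -> V})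
    (x y : V) :
  closure (range e) x -> closure (range e) y -> closure (range e) (x - y).
Proof.
move=> cx cy B /nbhs_ballP[r /= r0 rB].
have r2 : 0 < r / 2 by rewrite divr_gt0.
have [_ [[p _ <-] px]] := cx _ (nbhsx_ballx x _ r2).
have [_ [[q _ <-] qy]] := cy _ (nbhsx_ballx y _ r2).
exists (e p - e q); split; first by exists (p - q) => //; rewrite linearB.
apply: rB; move: px qy; rewrite -!ball_normE/= => px qy.
have -> : x - y - (e p - e q) = (x - e p) - (y - e q).
  by rewrite !opprB addrACA [RHS]addrACA; congr (_ + _); rewrite addrC.
by rewrite (le_lt_trans (ler_normB _ _))// (splitr r) ltrD.
Qed.

Lemma continuous_linear_norm_le {R : realType} {X Y : normedModType R}
    (e : {linear X -> Y}) :
  continuous e -> exists2 C : R, 0 < C & forall x, `|e x| <= C * `|x|.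
Proof.
move=> /(_ 0)/continuous_linear_bounded/linear_boundedP.
move=> [M [_ hM]]; exists (`|M| + 1); first by rewrite ltr_wpDl.
by apply: hM; rewrite (le_lt_trans (ler_norm M))// ltrDl.
Qed.

(** * Precompactness in metric spaces *)

(** An ultrafilter containing no [A i] contains every complement, hence their finite intersection,
    which misses [B]. *)
Lemma in_ultra_bigcup {T : Type} {I : finType} (F : set_system T) (A : I -> set T)
    (B : set T) :
  UltraFilter F -> F B -> B `<=` \bigcup_i A i -> exists i, F (A i).
Proof.
move=> FU FB BA; apply: contrapT => /forallNP nA.
have FnA : F [set x | forall i, ~ A i x].
  apply: (@filter_forall _ _ (fun i x => ~ A i x)) => i.
  by have [/nA|] := in_ultra_setVsetC (A i) FU.
have [x [Bx nAx]] := filter_ex (filterI FB FnA).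
by have [i _ /(nAx i)] := BA x Bx.
Qed.

(** Total boundedness is phrased by maps [kappa] into finite types whose fibres have small image. At
    each scale [eps k] an ultrafilter then concentrates near some [x (s k)], and consecutive centres
    are close because their balls share a point. So completeness is asked only of such sequences. *)
Lemma precompact_of_classifiers {R : realType} {M : metricType R} {I : Type}
    (D : set I) (x : I -> M) (eps : nat -> R) :
  (forall k, 0 < eps k) -> eps @ \oo --> 0 ->
  (forall e, 0 < e -> exists (K : finType) (kappa : I -> K), forall i j,
    D i -> D j -> kappa i = kappa j -> mdist (x i) (x j) <= e) ->
  (forall s : nat -> I, (forall k, D (s k)) ->
    (forall k, mdist (x (s k)) (x (s k.+1)) <= eps k + eps k.+1) ->
    exists z, mdist (x (s k)) z @[k --> \oo] --> 0) ->
  precompact (x @` D).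
Proof.
move=> eps0 epsl tot lim; rewrite precompactE compact_ultra => F FU FA.
have cell k : exists i, D i /\ F [set z | mdist (x i) z < eps k].
  have e2 : 0 < eps k / 2 by rewrite divr_gt0.
  have [K [kappa kappaP]] := tot _ e2.
  (* [A c] gathers the points near the image of the class [c]; finitely many of these sets cover the
     closure, so the ultrafilter contains one. *)
  pose A (c : K) := [set z | exists i, [/\ D i, kappa i = c & mdist (x i) z < eps k / 2]].
  have [c Fc] : exists c, F (A c).
    apply: (in_ultra_bigcup FU FA) => z cz.
    have [_ [[i Di <-] zi]] := cz _ (nbhsx_ballx z _ e2).
    exists (kappa i) => //; exists i; split => //.
    by rewrite metric_sym; move: zi; rewrite ballEmdist.
  have [z [i [Di ki _]]] := filter_ex Fc.
  exists i; split => //; apply: filterS Fc => w [j [Dj kj jw]] /=.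
  rewrite (le_lt_trans (metric_triangle _ (x j) _))// (splitr (eps k)).
  by rewrite ler_ltD// kappaP// ki kj.
have [s sP] := choice cell.
have [|z sz] := lim s (fun k => (sP k).1).
  move=> k; have [w [kw k1w]] := filter_ex (filterI (sP k).2 (sP k.+1).2).
  rewrite (le_trans (metric_triangle _ w _))// lerD// ltW//.
  by rewrite metric_sym.
have small e : 0 < e -> exists k, mdist (x (s k)) z < e / 2 /\ eps k < e / 2.
  move=> e0; have e2 : 0 < e / 2 by rewrite divr_gt0.
  have /cvgrPdist_lt/(_ _ e2) h1 := sz.
  have /cvgrPdist_lt/(_ _ e2) h2 := epsl.
  have [k [/= k1 k2]] := filter_ex (filterI h1 h2); exists k.
  move: k1 k2; rewrite !sub0r !normrN ger0_norm ?mdist_ge0//.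
  by rewrite gtr0_norm.
exists z; split.
  move=> B /nbhs_ballP[e /= e0 eB]; have [k [k1 k2]] := small _ e0.
  exists (x (s k)); split; first by exists (s k) => //; exact: (sP k).1.
  apply: eB; rewrite ballEmdist/= metric_sym (lt_le_trans k1)//.
  by rewrite ler_pdivrMr// ler_peMr ?ler1n// ltW.
move=> B /nbhs_ballP[e /= e0 eB]; have [k [k1 k2]] := small _ e0.
apply: filterS (sP k).2 => w /= kw; apply: eB; rewrite ballEmdist/=.
rewrite (le_lt_trans (metric_triangle _ (x (s k)) _))// (splitr e) ltrD//.
  by rewrite metric_sym.
exact: lt_trans kw k2.
Qed.

(** A point is classified by the first ball containing it in a finite cover by balls of radius
    [e / 2]. Outside the cover [find] returns the length of the list, whence the extra class. *)
Lemma precompact_classifier {R : realType} {X : normedModType R} (A : set X) (e : R) :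
  precompact A -> 0 < e -> exists m (kappa : X -> 'I_m.+1), forall x y,
    A x -> A y -> kappa x = kappa y -> `|x - y| <= e.
Proof.
move=> + e0; rewrite precompactE compact_cover => cA.
have e2 : 0 < e / 2 by rewrite divr_gt0.
have [||D _ AD] := cA X setT (fun c => (ball c (e / 2))°).
- by move=> c _; exact: open_interior.
- move=> x _; exists x => //; exact: nbhsx_ballx.
pose s : seq X := finmap.enum_fset D; pose f x := find (fun c => `[< ball c (e / 2) x >]) s.
have fP x : A x -> ball (s`_(f x)) (e / 2) x /\ (f x < size s)%N.
  move=> /(subset_closure)/AD[c /= cD xc].
  have hs : has (fun c => `[< ball c (e / 2) x >]) s.
    by apply/hasP; exists c => //; apply/asboolP; exact: interior_subset xc.
  by split; [exact/asboolP/(nth_find 0 hs)|rewrite -has_find].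
exists (size s), (fun x => inord (f x)) => x y Ax Ay /(congr1 val)/=.
have [xb xs] := fP _ Ax; have [yb ys] := fP _ Ay.
rewrite (inordK (leqW xs)) (inordK (leqW ys)) => xy;
move: xb yb; rewrite xy -!ball_normE/= => xb yb.
rewrite -(subrKA (s`_(f y))) (le_trans (ler_normD _ _))// (splitr e).
by rewrite lerD// ltW// distrC.
Qed.

(** * Convergence in L^2 *)

Section L2distance.
Context {R : realType} {a b : R} {H : normedModType R}.
Local Notation mu := (@lebesgue_measure R).
Implicit Types (v w : R -> H) (f g : L2fun a b H).

Lemma measurable_sqr_norm (D : set R) v : measurable D ->
  strongly_measurable D v -> measurable_fun D (fun t => (`|v t| ^+ 2)%:E).
Proof.
move=> mD mv; apply/measurable_EFinP; apply: measurable_funX.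
by apply/(measurable_restrictT _ mD); exact: strongly_measurable_norm.
Qed.

Lemma bochner_norm2E v :
  (bochner_norm 2%:E a b v `^ 2 = \int[mu]_(t in `]a, b[) (`|v t| ^+ 2)%:E)%E.
Proof.
rewrite /bochner_norm poweR_Lnorm// [RHS]integral_mkcond.
apply: eq_integral => t _; rewrite /patch /=; case: ifP => _.
  by rewrite normr_id powR_mulrn.
by rewrite normr0 powR0.
Qed.

(** [mdist] is computed on chosen representatives of the classes, which agree with [f] and [g] only
    almost everywhere; the integral does not see the difference. *)
Lemma mdist_L2classE f g : ((mdist (L2class f) (L2class g)) ^+ 2)%:E =
  (\int[mu]_(t in `]a, b[) (`|f t - g t| ^+ 2)%:E)%E.
Proof.
have mI : measurable (`]a, b[ : set R) by [].
set x := L2class f; set y := L2class g.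
have rep (h : L2fun a b H) : repr (L2class h) = h %[ae mu in ([set` `]a, b[] : set R)].
  have : (\pi_(L2 a b H) (repr (L2class h)) = \pi_(L2 a b H) h)%qT by rewrite reprK.
  by move=> /eqmodP/asboolP.
have fin : bochner_norm 2%:E a b (fun t => repr x t - repr y t) \is a fin_num.
  rewrite ge0_fin_numE ?bochner_norm_ge0//.
  apply: le_lt_trans (le_bochner_normD (L2fun_meas (repr x)) (L2fun_meas (repr y)) _ _) _.
  - by apply: strongly_measurableB; exact: L2fun_meas.
  - by move=> t; exact: ler_normB.
  - by rewrite lte_add_pinfty// L2fun_fin.
transitivity (\int[mu]_(t in `]a, b[) (`|repr x t - repr y t| ^+ 2)%:E)%E.
  rewrite -bochner_norm2E -(fineK fin) poweR_EFin powR_mulrn//.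
  exact: fine_ge0 (bochner_norm_ge0 _ _ _ _).
apply: ge0_ae_eq_integral => //.
- apply: (measurable_sqr_norm (v := repr x \- repr y)) => //.
  by apply: strongly_measurableB; exact: L2fun_meas.
- apply: (measurable_sqr_norm (v := f \- g)) => //.
  by apply: strongly_measurableB; exact: L2fun_meas.
- have h1 := rep f; have h2 := rep g; move: h1 h2; rewrite -/x -/y.
  apply: (@filterS2 _ _ (ae_filter_ringOfSetsType mu)) => t h1 h2 Dt.
  by rewrite h1// h2.
Qed.

End L2distance.

(** * Completeness along fast Cauchy sequences of simple functions *)

Lemma fast_cauchy_cvg {R : realType} {X : completeNormedModType R} (x : nat -> X) (c : R) :
  (forall k, `|x k.+1 - x k| <= c * 2^-1 ^+ k) ->
  exists2 l, x @ \oo --> l & forall k, `|l - x k| <= 2 * c * 2^-1 ^+ k.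
Proof.
move=> h; have c0 : 0 <= c by have := h 0%N; rewrite expr0 mulr1; exact: le_trans.
have tail k n : `|x (k + n)%N - x k| <= 2 * c * 2^-1 ^+ k.
  (* The induction on [n] runs with the exact partial sum of the geometric series. *)
  suff: `|x (k + n)%N - x k| <= 2 * c * (2^-1 ^+ k - 2^-1 ^+ (k + n)).
    move=> /le_trans; apply; rewrite ler_wpM2l ?mulr_ge0// gerBl.
    by rewrite exprn_ge0.
  elim: n => [|n IH]; first by rewrite addn0 !subrr normr0 mulr0.
  rewrite -(subrKA (x (k + n)%N)) (le_trans (ler_normD _ _))//.
  rewrite addnS (le_trans (lerD (h _) IH))// exprS.
  lra.
have to0 : 2 * c * 2^-1 ^+ k @[k --> \oo] --> (0 : R).
  by apply: cvg_geometric; rewrite ger0_norm// invf_lt1// ltr1n.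
have cx : cauchy (x @ \oo).
  apply: cauchy_exP => e e0.
  have /cvgrPdist_lt/(_ _ e0)[K _ KP] := to0.
  exists (x K); exists K => //= n Kn; rewrite -ball_normE/= distrC.
  rewrite -(subnKC Kn) (le_lt_trans (tail _ _))//.
  by have := KP K (leqnn K); rewrite sub0r normrN ger0_norm// !mulr_ge0// exprn_ge0.
have /cvg_ex[l xl] : cvg (x @ \oo) by exact: cauchy_cvg.
exists l => // k; have xk : `|x n - x k| @[n --> \oo] --> `|l - x k|.
  by apply: cvg_norm; apply: cvgB => //; exact: cvg_cst.
by apply: (cvgr_to_le xk); exists k => //= n kn; rewrite -(subnKC kn) tail.
Qed.

Lemma simple_function_restrict {R : realType} {H : normedModType R} (E : set R)
    (v : R -> H) :
  measurable E -> simple_function v -> simple_function (v \_ E).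
Proof.
move=> mE [fv mv]; split.
  apply: (@sub_finite_set _ _ (range v `|` [set point])).
    by move=> _ [t _ <-]; rewrite /patch; case: ifP => _; [left; exists t|right].
  by rewrite finite_setU; split.
move=> y; rewrite preimage_restrict.
apply: measurableU; last exact: measurableI.
by case: ifP => _; [exact: measurableC|exact: measurable0].
Qed.

(** Riesz-Fischer with a rate: squared increments of integral at most $C8^{-k}$ stay summable after
    weighting by $4^k$, which forces geometric convergence wherever the weighted sum is finite. The
    [sg k], restricted to that set, witness the strong measurability of the limit. *)
Lemma L2_fast_limit {R : realType} {a b : R} {H : completeNormedModType R}
    (s : nat -> L2fun a b H) (sg : nat -> R -> H) (C : R) :
  (forall k, simple_function (sg k)) ->
  (forall k t, a < t < b -> s k t = sg k t) ->
  (forall k, (\int[lebesgue_measure]_(t in `]a, b[) (`|s k.+1 t - s k t| ^+ 2)%:E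
     <= (C * 8^-1 ^+ k)%:E)%E) ->
  exists z : L2fun a b H, forall k,
    (\int[lebesgue_measure]_(t in `]a, b[) (`|s k t - z t| ^+ 2)%:E
       <= (8 * C * 4^-1 ^+ k)%:E)%E.
Proof.
set mu := lebesgue_measure; set D := [set` `]a, b[].
move=> simple_sg sE sC.
have mD : measurable (D : set R) by exact: measurable_itv.
have DE t : D t -> a < t < b by rewrite /D/= in_itv.
pose w k t := (4 ^+ k * `|sg k.+1 t - sg k t| ^+ 2)%:E.
have w0 k t : (0 <= w k t)%E by rewrite lee_fin mulr_ge0// ?exprn_ge0// sqr_ge0.
have mw k : measurable_fun [set: R] (w k).
  apply/measurable_EFinP; apply: measurable_funM => //; apply: measurable_funX.
  exact: (simple_function_norm (simple_functionB (simple_sg k.+1) (simple_sg k))).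
(* [G] is integrable and dominates [4 ^+ k * `|sg k t - lim sg t| ^+ 2] up to a
   constant; where [G] is infinite the domination is void. *)
pose G t := (\sum_(k <oo) w k t)%E.
have G0 t : (0 <= G t)%E by apply: nneseries_ge0 => k _ _; exact: w0.
have mG : measurable_fun [set: R] G by apply: ge0_emeasurable_sum => // k t _ _; exact: w0.
(* The term of index $k$ contributes at most $4^k\cdot C8^{-k}=C2^{-k}$. *)
have intG : (\int[mu]_(t in D) G t <= (2 * C)%:E)%E.
  rewrite integral_nneseries; [|exact: mD| |]; last 2 first.
  - by move=> k; apply: measurable_funTS; exact: mw.
  - by move=> k t _; exact: w0.
  apply: lime_le.
    by apply: is_cvg_nneseries => k _ _; exact: integral_ge0.
  have C0 : 0 <= C.
    rewrite -[C]mulr1 -[X in C * X](expr0 8^-1) -lee_fin; apply: le_trans (sC 0%N).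
    by apply: integral_ge0 => t _; rewrite lee_fin sqr_ge0.
  near=> n.
  apply: (@le_trans _ _ (\sum_(0 <= k < n) (C * 2^-1 ^+ k)%:E)%E).
    apply: lee_sum => k _.
    have -> : (\int[mu]_(t in D) w k t = \int[mu]_(t in D)
        ((4 ^+ k)%:E * (`|s k.+1 t - s k t| ^+ 2)%:E))%E.
      by apply: eq_integral => t; rewrite inE => /DE abt; rewrite -EFinM !sE.
    rewrite ge0_integralZl_EFin//.
    - apply: le_trans (lee_wpmul2l _ (sC k)) _; first by rewrite lee_fin exprn_ge0.
      rewrite -EFinM lee_fin mulrCA -exprMn.
      by rewrite (_ : 4 * 8^-1 = 2^-1)//; field.
    - apply: (measurable_sqr_norm (v := s k.+1 \- s k)) => //.
      by apply: strongly_measurableB; exact: L2fun_meas.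
  rewrite sumEFin lee_fin -mulr_sumr mulrC ler_wpM2r//.
  suff -> : \sum_(0 <= k < n) 2^-1 ^+ k = 2 * (1 - 2^-1 ^+ n) :> R.
    by rewrite ler_piMr// gerBl exprn_ge0.
  elim: (n) => [|m IH]; first by rewrite big_geq// subrr mulr0.
  rewrite big_nat_recr//= IH exprS; lra.
have sqr_half : 2^-1 ^+ 2 = 4^-1 :> R by field.
(* A single term of [G] bounds the increment of index $k$ by $\sqrt{G(t)}\,2^{-k}$. Where [G] is
   infinite the limit is set to [point], the value that [sg k \_ E] takes there. *)
have lim t : exists l, ((G t < +oo)%E -> sg k t @[k --> \oo] --> l /\ forall k,
    `|sg k t - l| ^+ 2 <= 4 * 4^-1 ^+ k * fine (G t)) /\ (~ (G t < +oo)%E -> l = point).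
  have [Gt|Gt] := pselect (G t < +oo)%E; last by exists point.
  set c := Num.sqrt (fine (G t)).
  have cc : c ^+ 2 = fine (G t) by rewrite sqr_sqrtr// fine_ge0.
  have [k|l sl slk] := @fast_cauchy_cvg _ _ (fun k => sg k t) c.
    rewrite -(@ler_pXn2r _ 2)// ?nnegrE ?mulr_ge0 ?sqrtr_ge0 ?exprn_ge0//.
    rewrite exprMn cc exprAC sqr_half exprVn ler_pdivlMr ?exprn_gt0// mulrC.
    rewrite -lee_fin fineK ?ge0_fin_numE//.
    apply: le_trans (nneseries_lim_ge k.+1 _) => //.
    by rewrite big_nat_recr//= leeDr// sume_ge0.
  exists l; split => // _; split => // k.
  have := slk k; rewrite distrC => slk'.
  have : `|sg k t - l| ^+ 2 <= (2 * c * 2^-1 ^+ k) ^+ 2.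
    by rewrite ler_pXn2r// ?nnegrE// (le_trans _ slk').
  move=> /le_trans; apply.
  rewrite !exprMn cc exprAC sqr_half; lra.
have [z0 z0P] := choice lim.
pose E := [set t | (G t < +oo)%E].
have mE : measurable E.
  by rewrite -[E]setTI; exact: emeasurable_fun_infty_o.
have mz : strongly_measurable D z0.
  exists (fun k => sg k \_ E) => [k|t Dt]; first exact: simple_function_restrict.
  have [Et|Et] := pselect (E t).
    under eq_fun do rewrite patchT ?inE//.
    by have [/(_ Et)[]] := z0P t.
  under eq_fun do rewrite patchC ?inE//.
  by have [_ /(_ Et) ->] := z0P t; exact: cvg_cst.
have int_le k : (\int[mu]_(t in D) (`|s k t - z0 t| ^+ 2)%:E <= (8 * C * 4^-1 ^+ k)%:E)%E.
  apply: (@le_trans _ _ (\int[mu]_(t in D) ((4 * 4^-1 ^+ k)%:E * G t))%E).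
    apply: ge0_le_integral => //.
    - apply: (measurable_sqr_norm (v := s k \- z0)) => //.
      by apply: strongly_measurableB => //; exact: L2fun_meas.
    - by apply: measurable_funeM; exact: measurable_funTS.
    move=> t /DE abt; rewrite sE//.
    have [Et|Et] := pselect (E t).
      have [/(_ Et)[_ /(_ k)]] := z0P t.
      have -> : G t = (fine (G t))%:E by rewrite fineK// ge0_fin_numE.
      by rewrite -EFinM lee_fin.
    have -> : G t = +oo%E by apply/eqP; rewrite -leye_eq leNgt; exact/negP.
    by rewrite gt0_muley ?leey// lte_fin mulr_gt0// exprn_gt0// invr_gt0.
  rewrite ge0_integralZl_EFin//; last exact: measurable_funTS mG.
  apply: le_trans (lee_wpmul2l _ intG) _.
    by rewrite lee_fin mulr_ge0// exprn_ge0// invr_ge0.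
  by rewrite -EFinM lee_fin le_eqVlt; apply/orP; left; apply/eqP; ring.
(* [z0] is [s 0] minus [s 0 - z0], and the latter is square integrable by [int_le 0]. *)
have fz : (bochner_norm 2%:E a b z0 < +oo)%E.
  apply: (@le_lt_trans _ _
      (bochner_norm 2%:E a b (s 0%N) + bochner_norm 2%:E a b (s 0%N \- z0)%R)%E).
    apply: le_bochner_normD => //; first exact: L2fun_meas.
      by apply: strongly_measurableB => //; exact: L2fun_meas.
    by move=> t /=; rewrite -[X in `|X| <= _](subKr (s 0%N t)) ler_normB.
  rewrite lte_add_pinfty ?L2fun_fin// ltNge leye_eq; apply/negP => /eqP oo.
  have := int_le 0%N; rewrite -(@bochner_norm2E _ _ _ _ (s 0%N \- z0)) oo.
  by rewrite poweRyr.
by exists (MkL2fun mz fz).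
Unshelve. all: by end_near. Qed.

Lemma L2_fast_cauchy_cvg {R : realType} {a b : R} {H : completeNormedModType R}
    (s : nat -> L2fun a b H) (sg : nat -> R -> H) :
  (forall k, simple_function (sg k)) ->
  (forall k t, a < t < b -> s k t = sg k t) ->
  (forall k, mdist (L2class (s k)) (L2class (s k.+1)) <= 4^-1 ^+ k + 4^-1 ^+ k.+1) ->
  exists z, mdist (L2class (s k)) z @[k --> \oo] --> 0.
Proof.
(* The constant [4] comes from $(4^{-k}+4^{-k-1})^2\le(2\cdot4^{-k})^2\le4\cdot8^{-k}$. *)
move=> simple_sg sE sd; have [|z zP] := @L2_fast_limit _ _ _ _ s sg 4 simple_sg sE.
  move=> k; rewrite -mdist_L2classE metric_sym lee_fin.
  have q0 : 0 <= 4^-1 ^+ k :> R by rewrite exprn_ge0.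
  have d2 : mdist (L2class (s k)) (L2class (s k.+1)) <= 2 * 4^-1 ^+ k.
    by rewrite (le_trans (sd k))// exprS; lra.
  have le2 : mdist (L2class (s k)) (L2class (s k.+1)) ^+ 2 <= (2 * 4^-1 ^+ k) ^+ 2.
    by rewrite ler_pXn2r// nnegrE ?mdist_ge0// mulr_ge0.
  rewrite (le_trans le2)// exprMn exprAC (_ : 2 ^+ 2 = 4 :> R); last by ring.
  by rewrite ler_pM2l// lerXn2r ?nnegrE//; lra.
exists (L2class z).
(* The squared distance to the limit is at most $32\cdot4^{-k}\le(6\cdot2^{-k})^2$. *)
have to0 : 6 * 2^-1 ^+ k @[k --> \oo] --> (0 : R).
  by apply: cvg_geometric; rewrite ger0_norm// invf_lt1// ltr1n.
apply: (squeeze_cvgr _ (cvg_cst 0) to0); apply: nearW => k; rewrite mdist_ge0/=.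
have q0 : 0 <= 2^-1 ^+ k :> R by rewrite exprn_ge0.
rewrite -(@ler_pXn2r _ 2)// ?nnegrE ?mdist_ge0 ?mulr_ge0//.
have := zP k; rewrite -mdist_L2classE lee_fin => /le_trans; apply.
rewrite exprMn exprAC (_ : 2^-1 ^+ 2 = 4^-1 :> R); last by field.
by rewrite ler_wpM2r ?exprn_ge0//; lra.
Qed.

Lemma simple_function_if {R : realType} {H : normedModType R} (E : set R)
    (v : R -> H) (y : H) :
  measurable E -> simple_function v ->
  simple_function (fun t => if t \in E then y else v t).
Proof.
move=> mE [fv mv]; split.
  apply: (@sub_finite_set _ _ (range v `|` [set y])).
    by move=> _ [t _ <-]; case: ifP => _; [right|left; exists t].
  by rewrite finite_setU; split.
move=> z; rewrite (_ : _ @^-1` _ =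
  (if y == z then E else set0) `|` (v @^-1` [set z] `&` ~` E)).
  apply: measurableU; first by case: ifP.
  by apply: measurableI => //; exact: measurableC.
apply/seteqP; split => t /=.
  case: ifPn => [/set_mem Et <-|/negP tE <-]; first by left; rewrite eqxx.
  by right; split => // /mem_set.
case=> [|[<- tE]]; last by rewrite memNset.
by case: eqP => // -> Et; rewrite mem_set.
Qed.

(** By induction on [N]: the value is overridden on [A N.+1], which is disjoint from the earlier
    sets. Off these sets the result is arbitrary, but it is simple on the whole line. *)
Lemma simple_function_glue {R : realType} {H : normedModType R}
    (A : nat -> set R) (f : nat -> H) (N : nat) :
  (forall n, measurable (A n)) ->
  (forall n m t, A n t -> A m t -> n = m) ->
  exists2 sg, simple_function sg & forall n t, (n <= N)%N -> A n t -> sg t = f n.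
Proof.
move=> mA dA; elim: N => [|N [sg simple_sg sgE]].
  exists (cst (f 0%N)); last by move=> n t; rewrite leqn0 => /eqP ->.
  split=> [|y].
    by apply: (sub_finite_set _ (finite_set1 (f 0%N))) => _ [t _ <-].
  by rewrite preimage_cst; case: ifP.
exists (fun t => if t \in A N.+1 then f N.+1 else sg t).
  exact: simple_function_if.
move=> n t nN At; case: ifPn => [/set_mem AN|/negP AN]; first by rewrite (dA _ _ _ At AN).
apply: sgE => //; rewrite -ltnS ltn_neqAle nN andbT.
by apply/eqP => nE; apply: AN; rewrite -nE mem_set.
Qed.

(** * Step functions *)

Lemma timestep_gt0 {R : realType} (T : R) N : 0 < T -> (0 < N)%N -> 0 < timestep T N.
Proof. by move=> T0 N0; rewrite divr_gt0// ltr0n. Qed.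

Section TimeSteps.
Context {R : realType} (T : R) (N : nat).
Hypotheses (T0 : 0 < T) (N0 : (0 < N)%N).
Local Notation mu := (@lebesgue_measure R).
Local Notation dt := (timestep T N).

(** As the predecessor is truncated, index 0 gives the empty interval, so disjointness holds for all
    indices. *)
Definition step_itv n : set R := [set t | n.-1%:R * dt < t <= n%:R * dt].

Lemma natr_timestep : N%:R * dt = T.
Proof. by rewrite /timestep mulrC divfK// pnatr_eq0 -lt0n. Qed.

Lemma step_itvE n : step_itv n = `]n.-1%:R * dt, n%:R * dt]%classic.
Proof. by apply/seteqP; split => t /=; rewrite in_itv. Qed.

Lemma measurable_step_itv n : measurable (step_itv n).
Proof. by rewrite step_itvE; exact: measurable_itv. Qed.

Lemma step_itv_ex t : 0 < t < T -> exists2 n, (1 <= n <= N)%N & step_itv n t.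
Proof.
move=> /andP[t0 tT]; have ex : exists n, t <= n%:R * dt.
  by exists N; rewrite natr_timestep ltW.
case: (ex_minnP ex) => n tn nmin; exists n.
  rewrite nmin ?natr_timestep ?ltW// andbT lt0n; apply: contraTneq tn => ->.
  by rewrite mul0r -ltNge.
rewrite /step_itv/= tn andbT ltNge; apply/negP => /nmin.
case: n tn {nmin} => [|n] tn; last by rewrite ltnn.
by move: tn; rewrite mul0r leNgt t0.
Qed.

Lemma step_itv_inj n m t : step_itv n t -> step_itv m t -> n = m.
Proof.
have le p q : step_itv p t -> step_itv q t -> (p <= q)%N.
  move=> /andP[pt _] /andP[_ tq]; have := lt_le_trans pt tq.
  by rewrite ltr_pM2r ?timestep_gt0// ltr_nat; case: p {pt}.
by move=> nt mt; apply/eqP; rewrite eqn_leq !le.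
Qed.

(** Scalar majorant of the integrands, written with indicators so that it is measured and integrated
    term by term. *)
Definition step_sum (f : nat -> R) t := \sum_(1 <= n < N.+1) f n * \1_(step_itv n) t.

Lemma step_sumE (f : nat -> R) n t : (1 <= n <= N)%N -> step_itv n t -> step_sum f t = f n.
Proof.
move=> nN nt; rewrite /step_sum (bigD1_seq n)//=; last 2 first.
- by rewrite mem_index_iota ltnS.
- exact: iota_uniq.
rewrite indicE mem_set// mulr1 big1 ?addr0// => m mn.
rewrite indicE memNset ?mulr0// => mt; move/eqP: mn; apply.
exact: step_itv_inj mt nt.
Qed.

Lemma step_sum_ge0 (f : nat -> R) t : (forall n, 0 <= f n) -> 0 <= step_sum f t.
Proof. by move=> f0; apply: sumr_ge0 => n _; rewrite mulr_ge0. Qed.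

Lemma measurable_step_sum D (f : nat -> R) : measurable_fun D (EFin \o step_sum f).
Proof.
apply/measurable_EFinP; apply: measurable_funTS; apply: measurable_sum => n.
apply: measurable_funM => //.
by apply: measurable_indic; exact: measurable_step_itv.
Qed.

Lemma integral_step_sum_le (f : nat -> R) : (forall n, 0 <= f n) ->
  (\int[mu]_(t in `]0%R, T[) (step_sum f t)%:E <= (\sum_(1 <= n < N.+1) f n * dt)%:E)%E.
Proof.
move=> f0; have mI n : measurable (step_itv n) by exact: measurable_step_itv.
have -> : (\int[mu]_(t in `]0%R, T[) (step_sum f t)%:E =
    \int[mu]_(t in `]0%R, T[) \sum_(1 <= n < N.+1) ((f n)%:E * (\1_(step_itv n) t)%:E))%E.
  by apply: eq_integral => t _; rewrite /step_sum -sumEFin.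
rewrite ge0_integral_sum//; last first.
- by move=> n t _; rewrite mule_ge0// lee_fin.
- move=> n; apply: measurable_funeM; apply/measurable_EFinP.
  by apply: measurable_funTS; apply: measurable_indic; exact: mI.
rewrite -sumEFin; apply: lee_sum => n _.
rewrite ge0_integralZl_EFin//; last first.
  by apply/measurable_EFinP; apply: measurable_funTS; apply: measurable_indic; exact: mI.
rewrite integral_indic; [|exact: measurable_itv|exact: mI].
rewrite EFinM lee_wpmul2l ?lee_fin//.
apply: (@le_trans _ _ (mu (step_itv n))).
  apply: le_measure; rewrite ?inE; last by move=> t [].
    by apply: measurableI; [exact: mI|exact: measurable_itv].
  exact: mI.
rewrite step_itvE lebesgue_measure_itv/= lte_fin; case: ifP => _; last first.
  by rewrite lee_fin ltW// timestep_gt0.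
rewrite -EFinB lee_fin -mulrBl; case: n => [|n]/=; first by rewrite subrr mul0r ltW// timestep_gt0.
by rewrite -natrB// subSnn mul1r.
Qed.

End TimeSteps.

(** * Time shifts *)

(** Cauchy-Schwarz in additive form. With $s=\sqrt{l\Delta t}\le1$, summing $a\le sa^2+1/s$ against
    $\Delta t$ gives at most $sC+l\Delta t/s=sC+s$, and the summand 1 contributes $l\Delta t=s^2\le
    s$. *)
Lemma sum_step_le {R : realType} (a : nat -> R) (dt C : R) (N n l : nat) :
  0 < dt -> (0 < l)%N -> (n + l <= N)%N -> l%:R * dt <= 1 ->
  \sum_(1 <= m < N.+1) a m ^+ 2 * dt <= C ->
  \sum_(j < l) dt * (a (n + j.+1)%N + 1) <= (C + 2) * Num.sqrt (l%:R * dt).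
Proof.
move=> dt0 l0 nlN h1 aC; set s := Num.sqrt _.
have h0 : 0 < l%:R * dt by rewrite mulr_gt0// ltr0n.
have s0 : 0 < s by rewrite sqrtr_gt0.
have ss : s ^+ 2 = l%:R * dt by rewrite sqr_sqrtr// ltW.
have s1 : s <= 1 by rewrite -[leRHS]sqrtr1 ler_wsqrtr.
have sumC : \sum_(j < l) a (n + j.+1)%N ^+ 2 * dt <= C.
  apply: le_trans aC; rewrite -(big_mkord predT (fun j => a (n + j.+1)%N ^+ 2 * dt)).
  have -> : \sum_(0 <= j < l) a (n + j.+1)%N ^+ 2 * dt =
            \sum_(n.+1 <= m < n.+1 + l) a m ^+ 2 * dt.
    rewrite addnC -{1}[n.+1]add0n big_addn addnK.
    by apply: eq_bigr => j _; rewrite addnS addnC -addnS.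
  have n1 : (n.+1 <= N.+1)%N by rewrite ltnS (leq_trans _ nlN)// leq_addr.
  have n2 : (n.+1 + l <= N.+1)%N by rewrite addSn ltnS.
  rewrite (big_cat_nat (n := n.+1) _ n1)// (big_cat_nat (leq_addr l n.+1) n2)//=.
  have p m : 0 <= a m ^+ 2 * dt by rewrite mulr_ge0 ?sqr_ge0// ltW.
  by rewrite addrCA lerDl addr_ge0// sumr_ge0.
have -> : (C + 2) * s = s * C + s + s by ring.
apply: (@le_trans _ _ (\sum_(j < l) (s * (a (n + j.+1)%N ^+ 2 * dt) + dt / s + dt))).
  apply: ler_sum => j _; set x := a _.
  have xs : x <= s * x ^+ 2 + s^-1.
    rewrite -(ler_pM2r s0) mulrDl mulVf ?gt_eqF//; nra.
  have := ler_wpM2l (ltW dt0) xs; lra.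
rewrite !big_split/= -mulr_sumr !sumr_const !card_ord -[(dt / s) *+ l]mulr_natl.
rewrite -[dt *+ l]mulr_natl mulrA -ss expr2 mulfK ?gt_eqF//.
rewrite !lerD//; first by rewrite ler_wpM2l// ltW.
by rewrite -subr_ge0 -{1}[s]mulr1 -mulrBr mulr_ge0 ?subr_ge0// ltW.
Qed.

Section ShiftBound.
Context {R : realType} (T : R) {V H : hilbertType R}.
Variables (iota : {linear V -> H})
  (Vn : nat -> nat -> hilbertType R) (eV : forall N n, {linear Vn N n -> V})
  (Qn : nat -> nat -> hilbertType R) (eQ : forall N n, {linear Qn N n -> V})
  (u : forall N n, Vn N n) (uH : nat -> nat -> H)
  (P : nat -> nat -> H -> H)
  (Qnl : nat -> nat -> nat -> hilbertType R)
  (eQnl : forall N l n, {linear Qnl N l n -> V})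
  (J : forall N l n i : nat, Qnl N l n -> Qn N (n + i)%N)
  (I : forall N l n i : nat, Vn N (n + i)%N -> V).

Local Notation dt N := (timestep T N).
Local Notation a := (fun N n => `|u N n|).

Variables (Ciota CV CQ CA CB CJ CI : R) (g : R -> R).
Hypotheses (T0 : 0 < T) (Ciota0 : 0 < Ciota) (CV0 : 0 <= CV) (CQ0 : 0 <= CQ)
  (CA0 : 0 <= CA) (CB0 : 0 < CB) (CJ0 : 0 < CJ) (CI0 : 0 < CI).
Hypothesis iota_le : forall v, `|iota v| <= Ciota * `|v|.
Hypothesis eV_le : forall N n, (1 <= n <= N)%N -> forall v, `|eV N n v| <= CV * `|v|.
Hypothesis eQ_le : forall N n, (0 < N)%N -> (n <= N)%N ->
  forall q, `|eQ N n q| <= CQ * `|q|.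
Hypothesis uHE : forall N n, (1 <= n <= N)%N -> uH N n = iota (eV N n (u N n)).
Hypothesis sum_le : forall N, (0 < N)%N ->
  \sum_(1 <= n < N.+1) `|u N n| ^+ 2 * dt N <= CA.
Hypothesis proj : forall N n, (0 < N)%N -> (n <= N)%N ->
  orthogonal_projector (closure (range (iota \o eQ N n))) (P N n).
Hypothesis diff_le : forall N n, (n < N)%N ->
  (dual_norm (iota \o eQ N n) (P N n ((dt N)^-1 *: (uH N n.+1 - uH N n)))
     <= (CB * (`|u N n.+1| + 1))%:E)%E.
Hypothesis J_le : forall N l n, (1 <= l <= N)%N -> (1 <= n <= N - l)%N ->
  forall q : Qnl N l n,
  [/\ forall i, (i <= l)%N -> `|J i q| <= CJ * `|q|,
      forall j, (j < l)%N ->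
        hdot (iota (eQ N (n + j.+1)%N (J j.+1 q)) -
              iota (eQ N (n + j)%N (J j q))) (uH N (n + j.+1)%N)
        <= CJ * dt N * `|q| * `|u N (n + j.+1)%N|
    & forall i, (i <= l)%N ->
        `|iota (eQ N (n + i)%N (J i q)) - iota (eQnl N l n q)|
        <= CJ * Num.sqrt (l%:R * dt N) * `|q|].
Hypothesis g_ge0 : forall h : R, 0 <= h -> 0 <= g h.
Hypothesis g_cvg : g h @[h --> 0^'+] --> (0 : R).
Hypothesis I_le : forall N l n, (1 <= l <= N)%N -> (1 <= n <= N - l)%N ->
  forall i (v : Vn N (n + i)%N), (i <= l)%N ->
  [/\ closure (range (eQnl N l n)) (I l v),
      `|I l v| <= CI * `|v|
    & `|iota (I l v) - iota (eV N (n + i)%N v)| <= g (l%:R * dt N) * `|v|].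
Hypothesis ehrling : forall delta : R, 0 < delta -> exists Cdelta : R,
  forall N l n, (1 <= l <= N)%N -> (1 <= n <= N - l)%N ->
  forall v : V, closure (range (eQnl N l n)) v ->
  ((`|iota v|)%:E <= (delta * `|v|)%:E
     + Cdelta%:E * dual_norm (iota \o eQnl N l n) (iota v))%E.

Lemma uH_le N n : (1 <= n <= N)%N -> `|uH N n| <= Ciota * CV * a N n.
Proof.
move=> nN; rewrite uHE// (le_trans (iota_le _))// -mulrA ler_pM2l//.
exact: eV_le.
Qed.

Lemma pairing_le : exists2 K : R, 0 < K & forall N l n,
  (1 <= l <= N)%N -> (1 <= n <= N - l)%N -> l%:R * dt N <= 1 ->
  forall q : Qnl N l n, `|q| <= 1 ->
  `|hdot (uH N (n + l)%N - uH N n) (iota (eQnl N l n q))| <=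
    K * Num.sqrt (l%:R * dt N) * (a N (n + l)%N + a N n + 1).
Proof.
(* [K0] serves the two endpoint terms of the summation by parts. In [K1], [CJ] comes from (C1),
   [CB * CJ] from (B) and [CA + 2] from [sum_step_le]. *)
pose K0 := Ciota * CV * CJ; pose K1 := (CJ + CB * CJ) * (CA + 2).
have K00 : 0 <= K0 by rewrite !mulr_ge0// ltW.
have K10 : 0 < K1.
  apply: mulr_gt0; last by rewrite ltr_wpDl.
  by rewrite addr_gt0// mulr_gt0.
exists (K0 + K1) => [|N l n lN nNl h1]; first by rewrite ltr_wpDl.
have [l0 lN'] := andP lN; have [n0 nNl'] := andP nNl.
have nlN : (n + l <= N)%N by rewrite -(subnK lN') leq_add2r.
have N0 : (0 < N)%N by exact: leq_trans l0 lN'.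
have dt0 := timestep_gt0 T0 N0.
set s := Num.sqrt _; have s0 : 0 <= s by rewrite sqrtr_ge0.
(* [J] is not assumed linear, but the bounds hold for both [q] and [- q] *)
suff one_sided (q : Qnl N l n) : `|q| <= 1 ->
    hdot (uH N (n + l)%N - uH N n) (iota (eQnl N l n q)) <=
    (K0 + K1) * s * (a N (n + l)%N + a N n + 1).
  move=> q q1; rewrite ler_norml one_sided// andbT lerNl -hdotNr.
  by rewrite -2!linearN one_sided// normrN.
move=> q1; have [J1 J2 J3] := J_le lN nNl q.
pose x j := uH N (n + j)%N; pose y j := iota (eQ N (n + j)%N (J j q)).
have nn : (1 <= n <= N)%N by rewrite n0 (leq_trans _ nlN)// leq_addr.
have nnl : (1 <= n + l <= N)%N by rewrite nlN andbT (leq_trans n0)// leq_addr.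
have -> : uH N n = x 0%N by rewrite /x addn0.
rewrite (hdot_summation_by_parts x y _ l).
have J3' i : (i <= l)%N -> `|y i - iota (eQnl N l n q)| <= CJ * s.
  move=> il; apply: (le_trans (J3 _ il)).
  by rewrite -[leRHS]mulr1 ler_wpM2l// mulr_ge0// ltW.
have t1 : hdot (x l) (iota (eQnl N l n q) - y l) <= K0 * s * a N (n + l)%N.
  apply: (le_trans (hdot_le _ _)); rewrite distrC.
  apply: (le_trans (ler_pM _ _ (uH_le nnl) (J3' l (leqnn l)))) => //.
  by rewrite /K0; lra.
have t2 : hdot (x 0%N) (y 0%N - iota (eQnl N l n q)) <= K0 * s * a N n.
  apply: (le_trans (hdot_le _ _)).
  have -> : x 0%N = uH N n by rewrite /x addn0.
  apply: (le_trans (ler_pM _ _ (uH_le nn) (J3' 0%N (leq0n l)))) => //.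
  by rewrite /K0; lra.
have t3 : \sum_(j < l) (hdot (y j.+1 - y j) (x j.+1) + hdot (x j.+1 - x j) (y j))
    <= K1 * s.
  rewrite /K1 -[leRHS]mulrA.
  apply: (le_trans _ (ler_wpM2l _ (sum_step_le dt0 l0 nlN h1 (sum_le N0)))); last first.
    by rewrite addr_ge0// ?mulr_ge0// ltW.
  rewrite mulr_sumr; apply: ler_sum => j _; rewrite mulrDl; apply: lerD.
    apply: (le_trans (J2 _ (ltn_ord j))).
    have a0 : 0 <= `|u N (n + j.+1)%N| by [].
    have : CJ * dt N * `|q| * `|u N (n + j.+1)%N| <= CJ * dt N * 1 * `|u N (n + j.+1)%N|.
      by rewrite ler_wpM2r// ler_wpM2l// mulr_ge0// ltW.
    have := mulr_gt0 CJ0 dt0; rewrite /=; lra.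
  have njN : (n + j < N)%N by rewrite (leq_trans _ nlN)// -addnS leq_add2l.
  (* Since [y j] lies in the closure of $Q^{n+j}$, pairing with it does not distinguish the
     difference quotient from its projection, to which (B) applies. *)
  have [_ Pj] := proj N0 (ltnW njN) ((dt N)^-1 *: (uH N (n + j).+1 - uH N (n + j)%N)).
  have /Pj : closure (range (iota \o eQ N (n + j)%N)) (y j).
    by apply: subset_closure; exists (J j q).
  rewrite hdotBl => /eqP; rewrite subr_eq0 hdotZl => /eqP dE.
  have -> : hdot (x j.+1 - x j) (y j) = dt N *
      hdot (P N (n + j)%N ((dt N)^-1 *: (uH N (n + j).+1 - uH N (n + j)%N))) (y j).
    by rewrite -dE /x addnS mulVKf// gt_eqF.
  rewrite mulrCA ler_pM2l// addnS (le_trans (ler_norm _))//.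
  apply: (le_trans (hdot_le_dual_norm (e := iota \o eQ N (n + j)%N) (J j q) (diff_le njN))).
  have Jq : `|J j q| <= CJ.
    by rewrite (le_trans (J1 _ (ltnW (ltn_ord j))))// -[leRHS]mulr1 ler_pM2l.
  rewrite [leRHS]mulrAC; apply: ler_wpM2l => //.
  by rewrite mulr_ge0 ?addr_ge0// ltW.
have a0 : 0 <= a N n by [].
have a1 : 0 <= a N (n + l)%N by [].
apply: (le_trans (lerD (lerD t1 t2) t3)).
have := mulr_ge0 (mulr_ge0 (ltW K10) s0) (addr_ge0 a0 a1).
have := mulr_ge0 K00 s0; lra.
Qed.

Lemma shift_bound (eps : R) : 0 < eps -> exists2 h0 : R, 0 < h0 & forall N l n,
  (1 <= l <= N)%N -> (1 <= n <= N - l)%N -> l%:R * dt N <= h0 ->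
  `|uH N (n + l)%N - uH N n| <= eps * (a N (n + l)%N + a N n + 1).
Proof.
move=> e0; have [K K0 pair] := pairing_le.
(* The [V] norm of the difference of the two $I$ values is at most [CI] times the sum of the two
   energies, so its share in (C3) is a quarter of [eps] times that sum. *)
pose delta := eps / (4 * CI).
have d0 : 0 < delta by rewrite divr_gt0// mulr_gt0.
have [Cd Cd_le] := ehrling d0.
(* [D] bounds the [H] norm on the unit ball of $Q^{n,l}$, by passing through $J^0q\in Q^n$, whose
   embedding constant is uniform. *)
pose D := Ciota * CQ * CJ + CJ.
have D0 : 0 < D by rewrite ltr_wpDl// !mulr_ge0// ltW.
(* [om] collects the terms that vanish with the shift *)
pose om := fun h : R => `|Cd| * (K * Num.sqrt h + D * g h) + g h.
have om_cvg : om h @[h --> 0^'+] --> (0 : R).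
  suff : om h @[h --> 0^'+] --> `|Cd| * (K * Num.sqrt 0 + D * 0) + 0.
    by rewrite sqrtr0 !mulr0 !addr0 mulr0.
  have sqrt_cvg : Num.sqrt h @[h --> 0^'+] --> Num.sqrt (0 : R).
    by apply: cvg_at_right_filter; exact: sqrt_continuous.
  rewrite /om; apply: cvgD; last exact: g_cvg.
  apply: cvgM; first exact: cvg_cst.
  apply: cvgD; (apply: cvgM; first exact: cvg_cst); last exact: g_cvg.
  exact: sqrt_cvg.
have : \forall h \near 0^'+, om h <= eps / 2.
  have e2 : 0 < eps / 2 by lra.
  have /cvgrPdist_le/(_ _ e2) := om_cvg; apply: filterS => h.
  by rewrite sub0r normrN; exact: le_trans (ler_norm _).
move=> [r /= r0 rP].
(* The bound 1 is the range of [pairing_le]; [r / 2] keeps the shift strictly inside the ball where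
   [om] is small. *)
exists (Num.min 1 (r / 2)); first by rewrite lt_min ltr01 divr_gt0.
move=> N l n lN nNl; rewrite le_min => /andP[h1 hr].
have [l0 lN'] := andP lN; have [n0 nNl'] := andP nNl.
have nlN : (n + l <= N)%N by rewrite -(subnK lN') leq_add2r.
have N0 : (0 < N)%N by exact: leq_trans l0 lN'.
have dt0 := timestep_gt0 T0 N0.
set h := l%:R * dt N in h1 hr *.
have h0 : 0 < h by rewrite mulr_gt0// ltr0n.
have om_le : om h <= eps / 2.
  by apply: rP => //; rewrite /ball_/= sub0r normrN gtr0_norm//; lra.
have nn : (1 <= n <= N)%N by rewrite n0 (leq_trans _ nlN)// leq_addr.
have nnl : (1 <= n + l <= N)%N by rewrite nlN andbT (leq_trans n0)// leq_addr.
have [cl Il gl] := I_le lN nNl (u N (n + l)%N) (leqnn l).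
(* For [i = 0] the map [I] acts on the type of index [n + 0]. Only norms and values in [H], whose
   types do not depend on the index, are rewritten back to [n]. *)
have [c0 I0 g0] := I_le lN nNl (u N (n + 0)%N) (leq0n l).
rewrite -uHE ?addn0 // in g0; rewrite -uHE // in gl.
have a00 : `|u N (n + 0)%N| = a N n by rewrite addn0.
rewrite a00 in I0 g0; have uH0 : uH N (n + 0)%N = uH N n by rewrite addn0.
rewrite uH0 in g0.
set v1 := I l _ in cl Il gl; set v0 := I l _ in c0 I0 g0.
set A := a N (n + l)%N + a N n.
have A0 : 0 <= A by rewrite addr_ge0.
have gh := g_ge0 (ltW h0).
(* The error in [H] of replacing the two step values by their $I$ images. *)
set rr := iota v1 - uH N (n + l)%N - (iota v0 - uH N n).
have rr_le : `|rr| <= g h * A.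
  by rewrite (le_trans (ler_normB _ _))// /A mulrDr lerD.
have rrE : iota (v1 - v0) = (uH N (n + l)%N - uH N n) + rr.
  rewrite /rr [RHS]addrC linearB/= -[LHS](subrK (uH N (n + l)%N - uH N n)).
  by congr (_ + _); rewrite !opprB addrACA [RHS]addrACA; congr (_ + _); rewrite addrC.
have dn : (dual_norm (iota \o eQnl N l n) (iota (v1 - v0)%R) <=
    ((K * Num.sqrt h + D * g h) * (A + 1))%:E)%E.
  apply: dual_norm_le => q q1; rewrite rrE hdotDl (le_trans (ler_normD _ _))//.
  rewrite mulrDl lerD//; first exact: pair.
  rewrite (le_trans (hdot_CauchySchwarz _ _))//.
  have q_le : `|iota (eQnl N l n q)| <= D.
    have [J1 _ J3] := J_le lN nNl q.
    have := J3 0%N (leq0n l); have := J1 0%N (leq0n l).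
    set y := eQ _ _ _; move=> y1 y2.
    have sq1 : Num.sqrt h <= 1 by rewrite -[leRHS]sqrtr1 ler_wsqrtr.
    have yy : `|iota y| <= Ciota * CQ * CJ.
      rewrite (le_trans (iota_le _))// -!mulrA ler_pM2l//.
      rewrite (le_trans (eQ_le _ _ _))// ?addn0//; first by case/andP: nn.
      rewrite ler_wpM2l// (le_trans y1)// -[leRHS]mulr1.
      by rewrite ler_pM2l.
    have y3 : `|iota y - iota (eQnl N l n q)| <= CJ.
      rewrite (le_trans y2)// -mulrA -[leRHS]mulr1 ler_pM2l//.
      by rewrite mulr_ile1// ?sqrtr_ge0.
    have -> : iota (eQnl N l n q) = iota y - (iota y - iota (eQnl N l n q)).
      by rewrite subKr.
    by rewrite (le_trans (ler_normB _ _))// lerD.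
  have : `|rr| <= g h * (A + 1) by rewrite (le_trans rr_le)// ler_wpM2l// lerDl.
  move=> rr1; rewrite [leRHS](_ : _ = g h * (A + 1) * D); last by ring.
  exact: ler_pM.
have v_le : `|v1 - v0| <= CI * A.
  by rewrite (le_trans (ler_normB _ _))// /A mulrDr lerD.
have E1 : `|iota (v1 - v0)| <= delta * (CI * A)
    + `|Cd| * ((K * Num.sqrt h + D * g h) * (A + 1)).
  have := Cd_le N l n lN nNl _ (closure_rangeB cl c0).
  move: dn; have := dual_norm_ge0 (iota \o eQnl N l n) (iota (v1 - v0)).
  (* The bounds [dn] and nonnegativity leave only a finite dual norm. The sign of [Cd] is unknown,
     hence its absolute value. *)
  case: (dual_norm _ _) => [x||]//; rewrite !lee_fin => x0 xle.
  move=> /le_trans; apply; apply: lerD; first by rewrite ler_pM2l.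
  rewrite (le_trans (ler_norm _))// normrM ler_wpM2l//.
  by rewrite ger0_norm.
have -> : uH N (n + l)%N - uH N n = iota (v1 - v0) - rr by rewrite rrE addrK.
rewrite (le_trans (ler_normB _ _))// (le_trans (lerD E1 rr_le))//.
have dE : delta * (CI * A) = eps / 4 * A.
  by rewrite /delta; field; rewrite gt_eqF.
rewrite dE.
have : om h * (A + 1) <= eps / 2 * (A + 1) by rewrite ler_wpM2r// addr_ge0.
rewrite /om mulrDl mulrA.
have := mulr_ge0 (ltW e0) A0.
lra.
Qed.

End ShiftBound.

(** * Total boundedness *)

(* The cell [[c tau, (c+1) tau)] is represented by the step value of least
   energy among the steps that meet it. *)
Lemma cell_sample {R : realType} (T tau : R) (N c : nat) (a : nat -> R) :
  0 < T -> (0 < N)%N -> 0 < tau -> timestep T N <= tau -> c.+1%:R * tau <= T ->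
  exists2 m, (1 <= m <= N)%N & forall n t, (1 <= n <= N)%N -> step_itv T N n t ->
    0 < t -> c%:R * tau <= t < c.+1%:R * tau ->
    a m <= a n /\ `|n%:R * timestep T N - m%:R * timestep T N| <= 2 * tau.
Proof.
move=> T0 N0 tau0 dt_tau cT; set dt := timestep T N in dt_tau *.
have dt0 : 0 < dt by exact: timestep_gt0.
pose P (n : 'I_N.+1) := `[< (1 <= n)%N /\ exists t, [/\ step_itv T N n t, 0 < t &
  c%:R * tau <= t < c.+1%:R * tau] >].
(* The midpoint of the cell shows that some step meets it, so a minimum exists. *)
pose t0 := (c%:R + 2^-1) * tau.
have t0P : c%:R * tau <= t0 < c.+1%:R * tau.
  by rewrite /t0 -[c.+1%:R]natr1; apply/andP; split; lra.
have t0_gt0 : 0 < t0 by rewrite mulr_gt0// ltr_wpDl// ler0n.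
have [|n0 /andP[n01 n0N] n0t] := @step_itv_ex _ T N N0 t0.
  by rewrite t0_gt0; case/andP: t0P => _ /lt_le_trans; apply.
have Pn0 : P (inord n0).
  by apply/asboolP; rewrite inordK ?ltnS//; split => //; exists t0.
case: (Order.TotalTheory.arg_minP (fun i : 'I_N.+1 => a i) Pn0) => m /asboolP[m1 [s [sm s0 sc]]] min.
exists (m : nat); first by rewrite m1 -ltnS ltn_ord.
move=> n t /andP[n1 nN] tn tt0 tc; split.
  have /min : P (inord n).
    by apply/asboolP; rewrite inordK ?ltnS//; split => //; exists t.
  by rewrite inordK ?ltnS.
(* A step meeting the cell ends no earlier than the cell begins and, having length at most [tau], at
   most [tau] after the cell ends. *)
have near (k : nat) r : (1 <= k)%N -> step_itv T N k r -> c%:R * tau <= r < c.+1%:R * tau ->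
    c%:R * tau <= k%:R * dt <= c%:R * tau + 2 * tau.
  case: k => // k _ /andP[/= kr rk] /andP[cr rc]; rewrite (le_trans cr rk)/=.
  by move: kr rc; rewrite -[k.+1%:R]natr1 -[c.+1%:R]natr1 -/dt; lra.
have /andP[n2 n3] := near _ _ n1 tn tc; have /andP[m2 m3] := near _ _ m1 sm sc.
by rewrite ler_norml; apply/andP; split; lra.
Qed.

(** A large [N] is classified by the classes of its samples, one per cell; the finitely many small
    [N], for which a step may exceed a cell, each form their own class. Within a class the two
    functions are compared through their samples, and the energy bound integrates the error. *)
Lemma step_functions_classifier {R : realType} {H : normedModType R} (T C : R)
    (x : nat -> nat -> H) (a : nat -> nat -> R) (ubar : nat -> L2fun 0 T H) :
  0 < T -> (forall N n, 0 <= a N n) ->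
  (forall N n t, (1 <= n <= N)%N -> step_itv T N n t -> ubar N t = x N n) ->
  (forall N, (0 < N)%N -> \sum_(1 <= n < N.+1) a N n ^+ 2 * timestep T N <= C) ->
  (forall eps : R, 0 < eps -> exists2 h0 : R, 0 < h0 & forall N n m,
    (1 <= n <= N)%N -> (1 <= m <= N)%N ->
    `|n%:R * timestep T N - m%:R * timestep T N| <= h0 ->
    `|x N n - x N m| <= eps * (a N n + a N m + 1)) ->
  (forall r eps : R, 0 < eps -> exists k (kappa : H -> 'I_k), forall N n N' n',
    (1 <= n <= N)%N -> (1 <= n' <= N')%N -> a N n <= r -> a N' n' <= r ->
    kappa (x N n) = kappa (x N' n') -> `|x N n - x N' n'| <= eps) ->
  forall e : R, 0 < e -> exists (K : finType) (kappa : nat -> K), forall N N',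
    (0 < N)%N -> (0 < N')%N -> kappa N = kappa N' ->
    mdist (L2class (ubar N)) (L2class (ubar N')) <= e.
Proof.
move=> T0 a0 ubarE aC shift classify e e0.
have C0 : 0 <= C by apply: le_trans (aC 1%N isT); rewrite big_nat1 mulr_ge0 ?sqr_ge0 ?divr_ge0// ltW.
(* Twice the bound [12 * C + 14 * T] of [int_f], once for each of the two functions. *)
pose B := 24 * C + 28 * T.
have B0 : 0 < B by rewrite /B; lra.
pose eps := e / (B + 1).
have eps0 : 0 < eps by rewrite divr_gt0//; lra.
have epsB : eps ^+ 2 * B <= e ^+ 2.
  rewrite expr_div_n -mulrA ler_piMr ?sqr_ge0// mulrC ler_pdivrMr ?exprn_gt0//; nra.
have [h0 h00 shiftP] := shift _ eps0.
(* Enough cells that [2 * tau <= h0], so that the shift bound compares each step with the sample of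
   its cell. *)
have [M MP] : exists M : nat, 2 * T / h0 < M%:R.
  by exists (Num.bound (2 * T / h0)); rewrite archi_boundP// divr_ge0// ?mulr_ge0// ltW.
have M0 : (0 < M)%N.
  rewrite -(ltr_nat R); apply: le_lt_trans MP; rewrite divr_ge0// ?mulr_ge0// ltW//.
case: M MP M0 => // M MP _.
pose tau := T / M.+1%:R.
have tau0 : 0 < tau by rewrite divr_gt0// ltr0n.
have tauM : M.+1%:R * tau = T by rewrite /tau mulrC divfK// pnatr_eq0.
have tau_h0 : 2 * tau <= h0.
  by move: MP; rewrite ltr_pdivrMr// /tau mulrA ler_pdivrMr ?ltr0n// (mulrC h0) => /ltW.
have dt_tau N : (M.+1 <= N)%N -> timestep T N <= tau.
  move=> MN; rewrite ler_pM2l// lef_pV2 ?posrE ?ltr0n// ?ler_nat//.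
  exact: leq_trans MN.
(* The default 0 outside the range lets [choice] act on all pairs. *)
have sampleP (p : nat * nat) : exists m, (M.+1 <= p.1)%N -> (p.2 < M.+1)%N ->
    (1 <= m <= p.1)%N /\ forall n t, (1 <= n <= p.1)%N -> step_itv T p.1 n t ->
    0 < t -> p.2%:R * tau <= t < p.2.+1%:R * tau ->
    a p.1 m <= a p.1 n /\ `|n%:R * timestep T p.1 - m%:R * timestep T p.1| <= 2 * tau.
  have [/andP[MN cM]|no] := boolP ((M.+1 <= p.1)%N && (p.2 < M.+1)%N); last first.
    by exists 0%N => MN cM; rewrite MN cM in no.
  have [||m m1 mP] := @cell_sample R T tau p.1 p.2 (a p.1) T0 _ tau0 (dt_tau _ MN).
  - exact: leq_trans MN.
  - by rewrite -tauM ler_pM2r// ler_nat.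
  - by exists m.
have [smp0 smp0P] := choice sampleP.
pose smp N c := smp0 (N, c).
have smpP N c : (M.+1 <= N)%N -> (c < M.+1)%N -> (1 <= smp N c <= N)%N /\
    forall n t, (1 <= n <= N)%N -> step_itv T N n t ->
    0 < t -> c%:R * tau <= t < c.+1%:R * tau ->
    a N (smp N c) <= a N n /\
    `|n%:R * timestep T N - (smp N c)%:R * timestep T N| <= 2 * tau.
  by move=> MN cM; exact: (smp0P (N, c) MN cM).
have mD (A : interval R) : measurable ([set` A] : set R) by exact: measurable_itv.
(* Minimality integrated over the cell gives $\tau a_m^2\le\int a^2\le C$, a bound on the samples
   independent of [N]. *)
have smp_le N c : (M.+1 <= N)%N -> (c < M.+1)%N ->
    a N (smp N c) <= Num.sqrt (C / tau).
  move=> MN cM; have [smpN least] := smpP N c MN cM.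
  have N0 : (0 < N)%N by exact: leq_trans MN.
  have sq0 n : 0 <= a N n ^+ 2 by rewrite sqr_ge0.
  have Ct0 : 0 <= C / tau by rewrite divr_ge0// ltW.
  rewrite -(@ler_pXn2r _ 2)// ?nnegrE ?sqrtr_ge0// sqr_sqrtr//.
  rewrite ler_pdivlMr// -lee_fin; apply: le_trans (aC N N0 : (_%:E <= _%:E)%E).
  apply: le_trans (integral_step_sum_le T0 N0 sq0).
  pose cell := [set` `]c%:R * tau, c.+1%:R * tau[].
  have tc t : cell t -> 0 < t < T.
    rewrite /cell/= in_itv/= => /andP[ct tc]; rewrite (le_lt_trans _ ct)/=.
      by rewrite (lt_le_trans tc)// -tauM ler_pM2r// ler_nat.
    by rewrite mulr_ge0// ltW.
  apply: (@le_trans _ _ (\int[lebesgue_measure]_(t in cell)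
      (step_sum T N (fun n => a N n ^+ 2) t)%:E)%E); last first.
    apply: ge0_subset_integral.
    - exact: mD.
    - exact: mD.
    - exact: measurable_step_sum.
    - by move=> t _; rewrite lee_fin; exact: step_sum_ge0.
    - by move=> t /tc; rewrite /= in_itv.
  apply: (@le_trans _ _ (\int[lebesgue_measure]_(t in cell) (cst (a N (smp N c) ^+ 2)%:E t))%E).
    rewrite integral_cst ?[X in (_ * X)%E]lebesgue_measure_itv/=; last exact: mD.
    rewrite lte_fin ltr_pM2r// ltr_nat ltnSn -EFinB -mulrBl -natrB// subSnn mul1r.
    by rewrite -EFinM.
  apply: ge0_le_integral.
  - exact: mD.
  - by move=> t _; rewrite lee_fin.
  - exact: measurable_cst.
  - exact: measurable_step_sum.
  move=> t ct; have /andP[t0 tT] := tc _ ct.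
  have [|n nN nt] := @step_itv_ex _ T N N0 t; first by rewrite t0.
  rewrite /= (step_sumE T0 N0 _ nN nt) lee_fin.
  have [|amn _] := least n t nN nt t0.
    by move: ct; rewrite /cell/= in_itv/= => /andP[/ltW -> ->].
  by rewrite lerXn2r// nnegrE.
have [k [kap kapP]] := classify (Num.sqrt (C / tau)) eps eps0.
pose kappa N : 'I_M.+1 + {ffun 'I_M.+1 -> 'I_k} :=
  if (N < M.+1)%N then inl (inord N) else inr [ffun c => kap (x N (smp N (val c)))].
exists ('I_M.+1 + {ffun 'I_M.+1 -> 'I_k})%type, kappa => N N' N0 N'0.
rewrite /kappa; case: ltnP => MN; case: ltnP => MN' //.
  by case=> /(congr1 val)/=; rewrite !inordK// => ->; rewrite mdistxx ltW.
case=> /ffunP kapE.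
have samples (c : nat) : (c < M.+1)%N -> `|x N (smp N c) - x N' (smp N' c)| <= eps.
  move=> cM; have := kapE (Ordinal cM); rewrite !ffunE/=; apply: kapP.
  - exact: (smpP N c MN cM).1.
  - exact: (smpP N' c MN' cM).1.
  - exact: smp_le.
  - exact: smp_le.
have close_sample N1 n t c : (M.+1 <= N1)%N -> (c < M.+1)%N -> (1 <= n <= N1)%N ->
    step_itv T N1 n t -> 0 < t -> c%:R * tau <= t < c.+1%:R * tau ->
    `|x N1 n - x N1 (smp N1 c)| <= eps * (2 * a N1 n + 1).
  move=> MN1 cM nN1 nt t0 tc; have [smpN1 /(_ n t nN1 nt t0 tc)[least dist]] := smpP _ _ MN1 cM.
  apply: le_trans (shiftP _ _ _ nN1 smpN1 (le_trans dist tau_h0)) _.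
  by rewrite ler_pM2l//; lra.
(* From $(2x+2y+3)^2\le12x^2+12y^2+28$, split evenly between the two functions. *)
pose f N1 n := 12 * a N1 n ^+ 2 + 14.
have f0 N1 n : 0 <= f N1 n by rewrite addr_ge0// mulr_ge0// sqr_ge0.
have int_f N1 : (0 < N1)%N ->
    (\int[lebesgue_measure]_(t in `]0%R, T[) (step_sum T N1 (f N1) t)%:E
      <= (12 * C + 14 * T)%:E)%E.
  move=> N10; apply: le_trans (integral_step_sum_le T0 N10 (f0 N1)) _.
  rewrite lee_fin /f; under eq_bigr do rewrite mulrDl -mulrA.
  rewrite big_split/= -mulr_sumr sumr_const_nat subn1/=.
  rewrite lerD// ?ler_pM2l//; first exact: aC.
  by rewrite -mulrnAr -[timestep T N1 *+ N1]mulr_natl natr_timestep.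
rewrite -(@ler_pXn2r _ 2)// ?nnegrE ?mdist_ge0// ?(ltW e0)// -lee_fin mdist_L2classE.
apply: (@le_trans _ _ (\int[lebesgue_measure]_(t in `]0%R, T[)
    ((eps ^+ 2)%:E * ((step_sum T N (f N) t)%:E + (step_sum T N' (f N') t)%:E)))%E).
  apply: ge0_le_integral.
  - exact: mD.
  - by move=> t _; rewrite lee_fin sqr_ge0.
  - apply: (measurable_sqr_norm (v := ubar N \- ubar N')); first exact: mD.
    by apply: strongly_measurableB; exact: L2fun_meas.
  - by apply: measurable_funeM; apply: emeasurable_funD; exact: measurable_step_sum.
  move=> t; rewrite /= in_itv/= => t0T; have /andP[t0 tT] := t0T.
  have [n nN nt] := step_itv_ex N0 t0T.
  have [n' nN' nt'] := step_itv_ex N'0 t0T.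
  rewrite (step_sumE T0 N0 _ nN nt) (step_sumE T0 N'0 _ nN' nt').
  rewrite (ubarE _ _ _ nN nt) (ubarE _ _ _ nN' nt').
  pose c := Num.truncn (t / tau).
  have tc : c%:R * tau <= t < c.+1%:R * tau.
    by rewrite -ler_pdivlMr// -ltr_pdivrMr// truncn_itv// divr_ge0// ltW.
  have cM : (c < M.+1)%N.
    rewrite -(ltr_nat R) -(ltr_pM2r tau0) tauM; case/andP: tc => + _.
    by move=> /le_lt_trans; apply.
  have d1 := close_sample N n t c MN cM nN nt t0 tc.
  have d2 := close_sample N' n' t c MN' cM nN' nt' t0 tc.
  rewrite -EFinD -EFinM lee_fin.
  (* Triangle inequality through the two samples:
     $\varepsilon(2x+1)+\varepsilon+\varepsilon(2y+1)$. *)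
  have d : `|x N n - x N' n'| <= eps * (2 * a N n + 2 * a N' n' + 3).
    rewrite -(subrKA (x N (smp N c))) (le_trans (ler_normD _ _))//.
    rewrite -[X in _ + `|X|](subrKA (x N' (smp N' c))).
    have := ler_normD (x N (smp N c) - x N' (smp N' c)) (x N' (smp N' c) - x N' n').
    have := samples c cM; rewrite (distrC (x N' (smp N' c))); lra.
  apply: (@le_trans _ _ ((eps * (2 * a N n + 2 * a N' n' + 3)) ^+ 2)).
    by rewrite lerXn2r// ?nnegrE// (le_trans _ d).
  rewrite exprMn ler_wpM2l ?sqr_ge0// /f.
  have := sqr_ge0 (a N n - a N' n'); have := sqr_ge0 (2 * a N n - 3).
  have := sqr_ge0 (2 * a N' n' - 3); lra.
rewrite ge0_integralZl_EFin; last 4 first.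
- exact: mD.
- by move=> t _; rewrite adde_ge0// lee_fin step_sum_ge0.
- by apply: emeasurable_funD; exact: measurable_step_sum.
- exact: sqr_ge0.
rewrite ge0_integralD; last 5 first.
- exact: mD.
- by move=> t _; rewrite lee_fin step_sum_ge0.
- exact: measurable_step_sum.
- by move=> t _; rewrite lee_fin step_sum_ge0.
- exact: measurable_step_sum.
apply: le_trans (lee_wpmul2l _ (leeD (int_f N N0) (int_f N' N'0))) _.
  by rewrite lee_fin sqr_ge0.
rewrite -EFinD -EFinM lee_fin (le_trans _ epsB)// ler_wpM2l ?sqr_ge0// /B; lra.
Qed.

(** * Relative compactness of the family in $L^2(0,T;H)$ *)

Theorem theorem3p1 (R : realType) (T : R) (V H : hilbertType R)
  (iota : {linear V -> H})
  (Vn : nat -> nat -> hilbertType R) (eV : forall N n, {linear Vn N n -> V})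
  (Qn : nat -> nat -> hilbertType R) (eQ : forall N n, {linear Qn N n -> V})
  (u : forall N n, Vn N n) (uH : nat -> nat -> H) (ubar : nat -> L2fun 0 T H)
  (P : nat -> nat -> H -> H)
  (Qnl : nat -> nat -> nat -> hilbertType R)
  (eQnl : forall N l n, {linear Qnl N l n -> V})
  (J : forall N l n i : nat, Qnl N l n -> Qn N (n + i)%N)
  (I : forall N l n i : nat, Vn N (n + i)%N -> V) :
  0 < T ->
  compact_embedding iota ->
  (* V^n and Q^n *)
  (exists C : R, forall N n, (1 <= n <= N)%N ->
    embedding_with_constant C (eV N n)) ->
  (exists C : R, forall N n, (0 < N)%N -> (n <= N)%N ->
    embedding_with_constant C (eQ N n)) ->
  (forall N n, (1 <= n <= N)%N ->
    [/\ forall v, closure (range (iota \o eQ N n)) (iota (eV N n v)),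
        compact_embedding (iota \o eV N n)
      & dual_embedding (iota \o eQ N n)]) ->
  (* uH N n is u^n seen in H; u^0 is only given in H *)
  (forall N n, (1 <= n <= N)%N -> uH N n = iota (eV N n (u N n))) ->
  (forall N n t, (1 <= n <= N)%N ->
    n.-1%:R * timestep T N < t <= n%:R * timestep T N ->
    ubar N t = uH N n) ->
  (* (A) *)
  (exists2 C : R, 0 < C & forall N, (0 < N)%N ->
    [/\ \sum_(1 <= n < N.+1) `|u N n| ^+ 2 * timestep T N <= C,
        (bochner_norm +oo 0 T (ubar N) <= C%:E)%E
      & (bochner_norm 2%:E (timestep T N) T
           (time_shift (timestep T N) (ubar N) \- ubar N)%R ^+ 2
         <= (C * timestep T N)%:E)%E]) ->
  (* (B) *)
  (forall N n, (0 < N)%N -> (n <= N)%N ->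
    orthogonal_projector (closure (range (iota \o eQ N n))) (P N n)) ->
  (exists2 C : R, 0 < C & forall N n, (n < N)%N ->
    (dual_norm (iota \o eQ N n)
       (P N n ((timestep T N)^-1 *: (uH N n.+1 - uH N n)))
     <= (C * (`|u N n.+1| + 1))%:E)%E) ->
  (* (C1) *)
  (forall N l n, (1 <= l <= N)%N -> (1 <= n <= N - l)%N ->
    injective (eQnl N l n)) ->
  (exists2 C : R, 0 < C &
    forall N l n, (1 <= l <= N)%N -> (1 <= n <= N - l)%N ->
    forall q : Qnl N l n,
    [/\ forall i, (i <= l)%N -> `|J N l n i q| <= C * `|q|,
        forall j, (j < l)%N ->
          hdot (iota (eQ N (n + j.+1)%N (J N l n j.+1 q)) -
                iota (eQ N (n + j)%N (J N l n j q))) (uH N (n + j.+1)%N)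
          <= C * timestep T N * `|q| * `|u N (n + j.+1)%N|
      & forall i, (i <= l)%N ->
          `|iota (eQ N (n + i)%N (J N l n i q)) - iota (eQnl N l n q)|
          <= C * Num.sqrt (l%:R * timestep T N) * `|q|]) ->
  (* (C2) *)
  (exists2 C : R, 0 < C & exists g : R -> R,
    [/\ forall h, 0 <= h -> 0 <= g h,
        forall h k, 0 <= h -> h <= k -> g h <= g k,
        g h @[h --> 0^'+] --> (0 : R)
      & forall N l n, (1 <= l <= N)%N -> (1 <= n <= N - l)%N ->
        forall i (v : Vn N (n + i)%N), (i <= l)%N ->
        [/\ closure (range (eQnl N l n)) (I N l n i v),
            `|I N l n i v| <= C * `|v|
          & `|iota (I N l n i v) - iota (eV N (n + i)%N v)|
            <= g (l%:R * timestep T N) * `|v|]]) ->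
  (* (C3) *)
  (forall delta : R, 0 < delta -> exists Cdelta : R,
    forall N l n, (1 <= l <= N)%N -> (1 <= n <= N - l)%N ->
    forall v : V, closure (range (eQnl N l n)) v ->
    ((`|iota v|)%:E <= (delta * `|v|)%:E
       + Cdelta%:E * dual_norm (iota \o eQnl N l n) (iota v))%E) ->
  precompact [set L2class (ubar N) | N in [set N : nat | (0 < N)%N]].
Proof.
move=> T0 [[_ iota_cont] iota_cpt] [CV eV_le] [CQ eQ_le] _ uHE ubarE [CA CA0 A_le].
move=> proj [CB CB0 B_le] _ [CJ CJ0 J_le] [CI CI0 [g [g_ge0 _ g_cvg I_le]]] ehrling.
have [Ciota Ciota0 iota_le] := continuous_linear_norm_le iota_cont.
have eV_le' N n : (1 <= n <= N)%N -> forall v, `|eV N n v| <= `|CV| * `|v|.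
  move=> nN v; rewrite (le_trans ((eV_le N n nN).2 v))// ler_wpM2r//.
  exact: ler_norm.
have eQ_le' N n : (0 < N)%N -> (n <= N)%N -> forall q, `|eQ N n q| <= `|CQ| * `|q|.
  move=> N0 nN q; rewrite (le_trans ((eQ_le N n N0 nN).2 q))// ler_wpM2r//.
  exact: ler_norm.
have sum_le N : (0 < N)%N -> \sum_(1 <= n < N.+1) `|u N n| ^+ 2 * timestep T N <= CA.
  by move=> /A_le[].
have shift := shift_bound T0 Ciota0 (normr_ge0 CV) (normr_ge0 CQ) (ltW CA0) CB0 CJ0
  CI0 iota_le eV_le' eQ_le' uHE sum_le proj B_le J_le g_ge0 g_cvg I_le ehrling.
have ubarE' N n t : (1 <= n <= N)%N -> step_itv T N n t -> ubar N t = uH N n.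
  exact: ubarE.
(* The members of the family coincide with simple functions on $(0,T)$; for [N = 0] any simple
   function will do. *)
have simple N : exists sg, simple_function sg /\
    ((0 < N)%N -> forall t, 0 < t < T -> ubar N t = sg t).
  have [->|N0] := posnP N.
    have [||sg ssg _] := @simple_function_glue R H (fun=> set0) (fun=> 0) 0%N => //.
    by exists sg.
  have [||sg ssg sgE] := @simple_function_glue R H (step_itv T N) (uH N) N.
  - by move=> n; exact: measurable_step_itv.
  - by move=> n m t; exact: step_itv_inj.
  exists sg; split => // _ t t0T; have [n nN nt] := step_itv_ex N0 t0T.
  by rewrite (ubarE' _ _ _ nN nt) (sgE n)//; case/andP: nN.
have [sg sgP] := choice simple.
apply: (@precompact_of_classifiers _ _ _ _ _ (fun k => 4^-1 ^+ k)).
- by move=> k; rewrite exprn_gt0// invr_gt0.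
- under eq_fun do rewrite -[_ ^+ _]mul1r.
  by apply: cvg_geometric; rewrite ger0_norm// invf_lt1// ltr1n.
- apply: (@step_functions_classifier R H T CA uH (fun N n => `|u N n|)) => //.
  + move=> eps eps0; have [h0 h00 h0P] := shift _ eps0; exists h0 => // N.
    (* The shift bound goes forward by [l = m - n]; the opposite order follows by symmetry. *)
    have lt n m : (1 <= n <= N)%N -> (1 <= m <= N)%N -> (n < m)%N ->
        m%:R * timestep T N - n%:R * timestep T N <= h0 ->
        `|uH N m - uH N n| <= eps * (`|u N m| + `|u N n| + 1).
      move=> /andP[n1 nN] /andP[m1 mN] nm; rewrite -mulrBl -natrB ?(ltnW nm)// => h.
      have := h0P N (m - n)%N n; rewrite subnKC ?(ltnW nm)//; apply => //.
        by rewrite subn_gt0 nm/= (leq_trans (leq_subr _ _)).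
      by rewrite n1/= -(leq_add2r (m - n)) subnK ?subnKC// ?(ltnW nm)// (leq_trans (leq_subr _ _)).
    move=> n m nN mN; case: (ltngtP n m) => [nm|mn|->].
    * rewrite distrC => /(le_trans (ler_norm _)) /lt-/(_ nN mN nm).
      by rewrite distrC (addrC `|u N n|).
    * by move=> /(le_trans (ler_norm _)) /lt; exact.
    * by move=> _; rewrite subrr normr0 mulr_ge0 ?addr_ge0// ltW.
  + move=> r eps eps0.
    (* Step values of energy at most [r] come from a ball of [V] of radius [|CV| * r], whose image
       in [H] is precompact. *)
    have [|m [kappa kappaP]] := @precompact_classifier R H
        (iota @` [set v | `|v| <= `|CV| * r]) eps _ eps0.
      apply: iota_cpt; exists (`|CV| * r); split; first exact: num_real.
      by move=> M rM v /= /le_trans; apply; exact: ltW.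
    exists m.+1, kappa => N n N' n' nN nN' ar ar'; apply: kappaP.
    * by exists (eV N n (u N n)); rewrite ?uHE//= (le_trans (eV_le' _ _ nN _))// ler_wpM2l.
    * by exists (eV N' n' (u N' n')); rewrite ?uHE//= (le_trans (eV_le' _ _ nN' _))// ler_wpM2l.
- move=> s s0 sd; apply: (@L2_fast_cauchy_cvg _ _ _ H _ (sg \o s)) => //.
  + by move=> k; exact: (sgP _).1.
  + by move=> k t; exact: (sgP _).2 (s0 k) t.
Qed.
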